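(* Let $p>1$, $q>0$, and assume that $\sigma\equiv 0$ on $\partial S$. Then a solution $u$ of the problem $$\begin{cases} u_t(x,t)=\Delta_{p,\omega}u(x,t)+\lambda|u(x,t)|^{q-1}u(x,t), & (x,t)\in S\times(0,\infty),\\ \mu(z)\frac{\partial u}{\partial_p n}(z,t)+\sigma(z)|u(z,t)|^{p-2}u(z,t)=0, & (z,t)\in\partial S\times[0,\infty),\\ u(x,0)=u_0(x)\ge 0, & x\in\overline S,\end{cases}$$ satisfies $$\sum_{x\in S}u_t(x,t)=\lambda\sum_{x\in S}|u(x,t)|^{q-1}u(x,t)$$ for all $t>0$ in its interval of existence. Consequently, for every $\lambda>0$ and every nontrivial (nonnegative) initial data $u_0$, the solution $u$ blows up in finite time if and only if $q>1$.
   Context: Network: $G=(V,E)$ is a finite, connected, simple graph with a weight $\omega:V\times V\to[0,\infty)$, i.e. $\omega(x,x)=0$, $\omega(x,y)=\omega(y,x)$, and $\omega(x,y)>0$ iff $x\sim y$ ($x,y$ adjacent). $S$ is a connected induced subgraph of $G$ (identified with its vertex set), $|S|$ is its number of vertices, $\partial S=\{z\in V\setminus S: y\sim z\text{ for some }y\in S\}$, and $\overline S=S\cup\partial S$ is the network whose edges are the edges of $G$ with at least one endpoint in $S$ (so there are no edges between two vertices of $\partial S$ in $\overline S$, and $\omega$ is regarded as $0$ there). Operators, for $u:\overline S\to\mathbb R$, with the convention $|a|^{p-2}a=0$ if $a=0$: $\Delta_{p,\omega}u(x)=\sum_{y\in\overline S}|u(x)-u(y)|^{p-2}[u(y)-u(x)]\omega(x,y)$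 for $x\in\overline S$, and $\frac{\partial u}{\partial_p n}(z)=\sum_{y\in S}|u(z)-u(y)|^{p-2}[u(z)-u(y)]\omega(z,y)$ for $z\in\partial S$. For functions of $(x,t)$ they act in the variable $x$. Boundary coefficients: $\mu,\sigma:\partial S\to[0,\infty)$ with $\mu(z)+\sigma(z)>0$ for all $z\in\partial S$. Solution: a function $u$ on $\overline S\times[0,T)$, $0<T\le\infty$, with $u(x,\cdot)$ continuous on $[0,T)$ and differentiable in $(0,T)$ for each $x\in\overline S$, satisfying the problem for times in $[0,T)$, where $[0,T)$ is a maximal interval of existence. The solution blows up in finite time $T$ $(0<T<\infty)$ if there exists $x\in S$ such that $|u(x,t)|\to+\infty$ as $t\nearrow T^-$ (the paper states this equivalently as $\sum_{x\in S}|u(x,t)|\to+\infty$ as $t\nearrow T^-$). *)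

(* Defs.v *)
From HB Require Import structures.
From mathcomp Require Import all_boot all_order all_algebra.
From mathcomp Require Import all_classical all_reals all_analysis.

Set Implicit Arguments.
Unset Strict Implicit.
Unset Printing Implicit Defensive.
Import Order.TTheory GRing.Theory Num.Theory.
Import numFieldNormedType.Exports.

Local Open Scope classical_set_scope.
Local Open Scope ring_scope.

Definition connected_on (V : finType) (e : rel V) (A : {set V}) : Prop :=
  A != finset.set0 /\
  {in A &, forall x y, connect [rel a b | [&& a \in A, b \in A & e a b]] x y}.

Record is_network (R : realType) (V : finType) (e : rel V) (w : V -> V -> R)
    : Prop := IsNetwork {
  network_irr : irreflexive e ;
  network_sym : symmetric e ;
  network_connected : connected_on e [set: V]%SET ;
  weight_ge0 : forall x y, 0 <= w x y ;
  weight_diag : forall x, w x x = 0 ;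
  weight_sym : forall x y, w x y = w y x ;
  weight_gt0 : forall x y, 0 < w x y <-> e x y }.

Definition boundary (V : finType) (e : rel V) (S : {set V}) : {set V} :=
  [set z | (z \notin S) && [exists y in S, e y z]]%SET.

Definition gclosure (V : finType) (e : rel V) (S : {set V}) : {set V} :=
  (S :|: boundary e S)%SET.

(* The weight of the network on S and its boundary, which has no edge between
   two boundary vertices. *)
Definition cut_weight (R : realType) (V : finType) (S : {set V})
    (w : V -> V -> R) (x y : V) : R :=
  if (x \in S) || (y \in S) then w x y else 0.

(* In the expressions `|a| `^ (r - 2) * a below, the convention that the value
   is 0 at a = 0 holds for every exponent because powR is total. *)

Definition plaplacian (R : realType) (V : finType) (e : rel V) (S : {set V})
    (w : V -> V -> R) (p : R) (f : V -> R) (x : V) : R :=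
  \sum_(y in gclosure e S)
    `|f x - f y| `^ (p - 2) * (f y - f x) * cut_weight S w x y.

Definition pnormal (R : realType) (V : finType) (S : {set V})
    (w : V -> V -> R) (p : R) (f : V -> R) (z : V) : R :=
  \sum_(y in S) `|f z - f y| `^ (p - 2) * (f z - f y) * cut_weight S w z y.

(* A function on (S and its boundary) x [0, T) is represented by a total
   u : V -> R -> R whose values outside that domain are never constrained;
   T = +oo is allowed. *)
Record solves (R : realType) (V : finType) (e : rel V) (S : {set V})
    (w : V -> V -> R) (p q lambda : R) (mu sigma u0 : V -> R)
    (T : \bar R) (u : V -> R -> R) : Prop := Solves {
  solves_continuous : forall x, x \in gclosure e S ->
    {within [set t : R | 0 <= t /\ (t%:E < T)%E], continuous (u x)} ;
  solves_derivable : forall x, x \in gclosure e S ->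
    forall t : R, 0 < t -> (t%:E < T)%E -> derivable (u x) t 1 ;
  solves_equation : forall x, x \in S ->
    forall t : R, 0 < t -> (t%:E < T)%E ->
    derive1 (u x) t = plaplacian e S w p (u ^~ t) x
                  + lambda * (`|u x t| `^ (q - 1) * u x t) ;
  solves_boundary : forall z, z \in boundary e S ->
    forall t : R, 0 <= t -> (t%:E < T)%E ->
    mu z * pnormal S w p (u ^~ t) z
    + sigma z * (`|u z t| `^ (p - 2) * u z t) = 0 ;
  solves_initial : forall x, x \in gclosure e S -> u x 0 = u0 x }.

(* Maximality means that u has no proper extension; since uniqueness may fail
   (for instance when q < 1), other solutions with the same data could live
   longer. *)
Record is_solution (R : realType) (V : finType) (e : rel V) (S : {set V})
    (w : V -> V -> R) (p q lambda : R) (mu sigma u0 : V -> R)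
    (T : \bar R) (u : V -> R -> R) : Prop := IsSolution {
  solution_time_gt0 : (0 < T)%E ;
  solution_solves : solves e S w p q lambda mu sigma u0 T u ;
  solution_maximal : forall (T' : \bar R) (v : V -> R -> R), (T < T')%E ->
    solves e S w p q lambda mu sigma u0 T' v ->
    ~ (forall x, x \in gclosure e S ->
       forall t : R, 0 <= t -> (t%:E < T)%E -> v x t = u x t) }.

Definition blows_up_in_finite_time (R : realType) (V : finType) (S : {set V})
    (T : \bar R) (u : V -> R -> R) : Prop :=
  exists r : R, T = r%:E /\
    exists2 x, x \in S & `|u x t| @[t --> r^'-] --> +oo.

(* Main.v *)
Require Import Defs.
From HB Require Import structures.
From mathcomp Require Import all_boot all_order all_algebra.
From mathcomp Require Import all_classical all_reals all_analysis.
From mathcomp Require Import ring lra.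
Import Order.TTheory GRing.Theory Num.Theory.
Import numFieldNormedType.Exports.

(** Why the theorem holds. Let phi(a) = |a|^(p-2) a. When sigma = 0, the boundary
condition says that the p-flux through every boundary vertex vanishes.

The p-Laplacian of u at x is the sum over y of phi(u y - u x) times the weight of
xy, an antisymmetric expression, and zero flux lets sums over S be replaced by sums
over the closure. Hence, for every nondecreasing psi, the sum over S of psi(u)
times the p-Laplacian is at most 0 ([energy_interior_le0]), with equality when psi
is constant. The choice psi = 1 is the mass identity of the theorem. The choice
psi(a) = 2 a bounds the l2 norm exponentially when q <= 1, so that blow-up in
finite time implies q > 1 ([bounded_of_q_le1]). The choice psi(a) = 2 min(a, 0)
shows that solutions stay nonnegative when q > 1 ([sol_ge0]).

Let q > 1. The mass M is positive at time 0 and its derivative is at least a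
constant times M^q, so the lifespan is a finite r ([lifespan_finite]). It remains to
find a vertex at which u tends to infinity. Since u >= 0, its derivative at x is at
least - W phi(u x), which forbids oscillation: u x either tends to infinity or
converges as t tends to r ([blowup_or_limit]). If it converged at every x of S, the
solution could be continued past r, against maximality ([solves_extend]).

The continuation is a local existence theorem. A boundary value is the unique root
of a strictly increasing function and depends in a Lipschitz way on the interior
values ([balance_root_dist]), so the problem reduces to an ordinary differential
equation on S with a continuous right-hand side. It is not Lipschitz when p < 2,
whence a Peano theorem ([peano]). A solution must also be differentiable in time at
the boundary vertices, although the flux balance is degenerate (p > 2) or singular
(p < 2) where a boundary value meets an interior one; a rescaling argument settles
this ([balance_root_derivable]). *)

Set Implicit Arguments.
Unset Strict Implicit.
Unset Printing Implicit Defensive.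

Local Open Scope classical_set_scope.
Local Open Scope ring_scope.

(** * The function |a|^(p-2) a *)

Definition phi (R : realType) (p a : R) : R := `|a| `^ (p - 2) * a.

Section Phi.
Context {R : realType} (p : R).
Implicit Types a b : R.

Lemma phi0 : phi p 0 = 0.
Proof. by rewrite /phi mulr0. Qed.

Lemma phiN a : phi p (- a) = - phi p a.
Proof. by rewrite /phi normrN mulrN. Qed.

(** Multiplicativity is the homogeneity of the p-Laplacian; the derivative of
the boundary values below is found by rescaling with it. *)
Lemma phiM a b : phi p (a * b) = phi p a * phi p b.
Proof. by rewrite /phi normrM powRM//; ring. Qed.

Lemma phiE a : 0 < a -> phi p a = a `^ (p - 1).
Proof.
move=> a0; rewrite /phi gtr0_norm// -[X in _ * X](powRr1 (ltW a0)) -powRD.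
  by congr (_ `^ _); ring.
by rewrite (gt_eqF a0) /= implybT.
Qed.

Lemma phi_gt0 a : 0 < a -> 0 < phi p a.
Proof. by move=> a0; rewrite phiE// powR_gt0. Qed.

Lemma phi_ge0 a : 0 <= a -> 0 <= phi p a.
Proof. by move=> a0; rewrite /phi mulr_ge0// powR_ge0. Qed.

Lemma phi_le0 a : a <= 0 -> phi p a <= 0.
Proof. by move=> a0; rewrite -oppr_ge0 -phiN phi_ge0// oppr_ge0. Qed.

Hypothesis p1 : 1 < p.

Lemma norm_phi a : `|phi p a| = `|a| `^ (p - 1).
Proof.
have [->|a0] := eqVneq a 0; first by rewrite phi0 normr0 powR0// subr_eq0 gt_eqF.
rewrite -phiE ?normr_gt0// /phi normrM normr_id; congr (_ * _).
by rewrite ger0_norm// powR_ge0.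
Qed.

Lemma ltr_phi : {homo phi p : a b / a < b}.
Proof.
have pos a b : 0 <= a -> a < b -> phi p a < phi p b.
  rewrite le_eqVlt => /predU1P[<-|a0] ab; first by rewrite phi0 phi_gt0.
  have b0 := lt_trans a0 ab; rewrite !phiE//.
  have pp : 0 < p - 1 by rewrite subr_gt0.
  by apply: (gt0_ltr_powR pp) => //; rewrite nnegrE ltW.
move=> a b ab; have [a0|a0] := leP 0 a; first exact: pos.
have [b0|b0] := ltP 0 b.
  by rewrite (@le_lt_trans _ _ 0) ?phi_gt0// phi_le0// ltW.
by rewrite -ltrN2 -!phiN; apply: pos; rewrite ?oppr_ge0// ltrN2.
Qed.

Lemma ler_phi : {homo phi p : a b / a <= b}.
Proof. by move=> a b; rewrite !le_eqVlt => /predU1P[->|/ltr_phi ->]; rewrite ?eqxx ?orbT. Qed.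

Lemma phi_eq0 a : (phi p a == 0) = (a == 0).
Proof.
have [->|a0] := eqVneq a 0; first by rewrite phi0 eqxx.
by rewrite -normr_eq0 norm_phi powR_eq0 normr_eq0 (negPf a0).
Qed.

Lemma norm_powR_continuous (r : R) : 0 <= r -> {for 0, continuous (fun x : R => `|x| `^ r)}.
Proof.
rewrite le_eqVlt => /predU1P[<-|r0].
  have -> : (fun x : R => `|x| `^ 0) = cst 1 by apply/funext => x; rewrite powRr0.
  exact: cst_continuous.
apply/continuous_withinNx; rewrite normr0 powR0 ?gt_eqF//.
apply: (@cvg_comp _ _ _ (fun x : R => `|x|) (fun a => a `^ r) _ 0^'+); last exact: powR_cvg0.
move=> U [d /= d0 dU]; exists d => // z /=; rewrite sub0r normrN => zd z0.
by apply: dU => /=; rewrite ?sub0r ?normrN ?normr_id// normr_gt0.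
Qed.

(** For p < 2 the derivative is infinite at 0; everywhere else [phi p] is
differentiable, with a derivative that can vanish only at 0. *)
Lemma phi_derivable a : a != 0 \/ 2 <= p ->
  exists d, [/\ is_derive a (1 : R) (phi p) d, 0 <= d & a != 0 -> 0 < d].
Proof.
have pos (c : R) : 0 < c -> is_derive c (1 : R) (phi p) ((p - 1) * c `^ (p - 2)).
  move=> c0; apply: (@near_eq_is_derive _ _ _ (fun x => x `^ (p - 1))).
    by near=> x; rewrite phiE//; near: x; exact: lt_nbhsr.
  rewrite (_ : p - 2 = p - 1 - 1); last by ring.
  exact: is_derive1_powR.
have pos1 (c : R) : 0 < c -> 0 < (p - 1) * c `^ (p - 2).
  by move=> c0; rewrite mulr_gt0 ?powR_gt0 ?subr_gt0.
have [->|a0 _] := eqVneq a 0; last first.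
  exists ((p - 1) * `|a| `^ (p - 2)); split; last 2 first.
  - by rewrite ltW// pos1// normr_gt0.
  - by rewrite pos1// normr_gt0.
  have [{}a0|{}a0|/eqP] := ltgtP a 0; last by rewrite (negPf a0).
    rewrite ltr0_norm//.
    have -> : phi p = \- (phi p \o -%R).
      by apply/funext => x /=; rewrite phiN opprK.
    have h : is_derive (- a) (1 : R) (phi p) ((p - 1) * (- a) `^ (p - 2)).
      by apply: pos; rewrite oppr_gt0.
    have hN : is_derive a (1 : R) (-%R) (-1) by apply: is_deriveNid.
    apply: (is_derive_eq (is_deriveN (is_derive1_comp h hN))).
    by rewrite mulrN1 opprK.
  by rewrite gtr0_norm//; exact: pos.
case=> // p2; exists (`|0 : R| `^ (p - 2)); split; [|exact: powR_ge0|by []].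
apply/is_derive1_caratheodory; exists (fun x => `|x| `^ (p - 2)); split => //.
  by move=> z; rewrite phi0 !subr0.
by apply: norm_powR_continuous; rewrite subr_ge0.
Unshelve. all: by end_near. Qed.

Lemma phi_continuous : continuous (phi p).
Proof.
move=> a; have [->|a0] := eqVneq a 0; last first.
  have [d [h _ _]] := phi_derivable (or_introl a0).
  apply: differentiable_continuous; exact/derivable1_diffP.
rewrite /continuous_at phi0; apply: norm_cvg0.
under eq_fun do rewrite norm_phi.
have h : {for 0, continuous (fun x : R => `|x| `^ (p - 1))}.
  by apply: norm_powR_continuous; rewrite subr_ge0 ltW.
by move: h; rewrite /prop_for /continuous_at normr0 powR0// subr_eq0 gt_eqF.
Qed.

Lemma is_derive_phi a : a != 0 \/ 2 <= p -> is_derive a (1 : R) (phi p) ('D_1 (phi p) a).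
Proof. by case/phi_derivable => d [[/derivableP]]. Qed.

Lemma derive_phi_ge0 a : a != 0 \/ 2 <= p -> 0 <= 'D_1 (phi p) a.
Proof. by case/phi_derivable => d [[_ ->]]. Qed.

Lemma derive_phi_gt0 a : a != 0 -> 0 < 'D_1 (phi p) a.
Proof. by move=> a0; have [d [[_ ->] _]] := phi_derivable (or_introl a0); apply. Qed.
End Phi.

(** * Derivatives and limits of finite sums *)

Lemma cvg_sum_in (R : realType) (T : Type) (F : set_system T) (V : finType)
    (A : {set V}) (f : V -> T -> R) (l : V -> R) : Filter F ->
  (forall y, y \in A -> f y x @[x --> F] --> l y) ->
  \sum_(y in A) f y x @[x --> F] --> \sum_(y in A) l y.
Proof. by move=> FF h; apply: cvg_big => //; exact: add_continuous. Qed.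

Lemma is_derive_sum_in (R : realType) (V : finType) (A : {set V})
    (f : V -> R -> R) (d : V -> R) (t : R) :
  (forall y, y \in A -> is_derive t (1 : R) (f y) (d y)) ->
  is_derive t (1 : R) (fun s => \sum_(y in A) f y s) (\sum_(y in A) d y).
Proof.
move=> h; elim: (index_enum V) => [|y r IH].
  under eq_fun do rewrite big_nil; rewrite big_nil; exact: is_derive_cst.
under eq_fun do rewrite big_cons; rewrite big_cons.
by case: ifPn => // yA; apply: is_deriveD; exact: h.
Qed.

Lemma is_derive1P (R : realType) (f : R -> R) (t d : R) :
  is_derive t (1 : R) f d <-> (f (h + t) - f t) / h @[h --> 0^'] --> d.
Proof.
have E : (fun h : R => h^-1 *: ((f \o shift t) (h *: (1 : R)) - f t)) =
         (fun h => (f (h + t) - f t) / h).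
  by apply/funext => h /=; rewrite /GRing.scale /= mulr1 mulrC.
split=> [[+ <-]|h]; first by rewrite /derivable /derive E.
have df : derivable f t 1 by rewrite /derivable E; apply/cvg_ex; exists d.
by apply: DeriveDef => //; rewrite /derive E; exact/cvg_lim.
Qed.

(** This form of the derivative is the one that survives pointwise limits, and
it can be checked separately on each side of [t]. *)
Lemma is_derive_slope (R : realType) (f : R -> R) (t d : R) :
  (forall eta, 0 < eta -> exists2 rho, 0 < rho & forall s, `|s - t| < rho ->
     `|f s - f t - (s - t) * d| <= eta * `|s - t|) ->
  is_derive t (1 : R) f d.
Proof.
move=> H; apply/is_derive1P/cvgrPdistC_le => eta eta0.
have [rho rho0 Hrho] := H _ eta0.
exists rho => // h /=; rewrite sub0r normrN => hrho h0.
have := Hrho (h + t); rewrite addrK => /(_ hrho).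
rewrite -ler_pdivrMr ?normr_gt0// -normf_div.
by rewrite (_ : (_ - h * d) / h = (f (h + t) - f t) / h - d)//; field.
Qed.

(** * The balanced boundary value *)

Section Balance.
Context {R : realType} {V : finType} (S : {set V}) (p : R) (k : V -> R).

(** The p-flux from a vertex with value [c] to the vertices of [S], which carry
the values [X], along edges of weights [k]: the p-normal derivative at a boundary
vertex, as a function of its own value. *)
Definition balance (c : R) (X : V -> R) : R :=
  \sum_(y in S) phi p (c - X y) * k y.

(** Below [- \sum |D y|] all terms are nonpositive, above [\sum |D y|] all are
nonnegative, so the intermediate value theorem applies. *)
Lemma sum_root (g : V -> R -> R) (D : V -> R) :
  (forall y, y \in S -> continuous (g y)) ->
  (forall y s, y \in S -> 0 <= s -> 0 <= g y s) ->
  (forall y s, y \in S -> s <= 0 -> g y s <= 0) ->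
  exists c, \sum_(y in S) g y (c - D y) = 0.
Proof.
move=> gc gp gn; pose K := \sum_(y in S) `|D y|.
have DK y : y \in S -> `|D y| <= K.
  by move=> yS; rewrite /K (bigD1 y)//= lerDl sumr_ge0.
have K0 : - K <= K by rewrite ge0_cp// sumr_ge0.
have cg : {within `[- K, K], continuous (fun c => \sum_(y in S) g y (c - D y))}.
  apply: continuous_subspaceT => c; apply: cvg_sum_in => y yS.
  apply: (@continuous_comp _ _ _ (fun c => c - D y) (g y)); last exact: gc.
  by apply: cvgB; [exact: cvg_id|exact: cvg_cst].
have [c _ Hc] : exists2 c, c \in `[- K, K] & \sum_(y in S) g y (c - D y) = 0.
  apply: IVT => //; rewrite ge_min le_max; apply/andP; split; apply/orP.
    left; apply: sumr_le0 => y yS; apply: gn => //.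
    by have := DK y yS; rewrite ler_norml; lra.
  right; apply: sumr_ge0 => y yS; apply: gp => //.
  by have := DK y yS; rewrite ler_norml; lra.
by exists c.
Qed.

Lemma sum_strict (g : V -> R -> R) (D : V -> R) (a b : R) :
  (forall y, y \in S -> {homo g y : s t / s <= t}) ->
  (exists2 y, y \in S & {homo g y : s t / s < t}) -> a < b ->
  \sum_(y in S) g y (a - D y) < \sum_(y in S) g y (b - D y).
Proof.
move=> gm [y0 y0S g0] ab; rewrite (bigD1 y0)//= [ltRHS](bigD1 y0)//=.
apply: ltr_leD; first by apply: g0; rewrite ltrD2r.
by apply: ler_sum => y /andP[yS _]; apply: gm => //; rewrite lerD2r ltW.
Qed.

Hypothesis p1 : 1 < p.
Hypothesis k0 : forall y, y \in S -> 0 <= k y.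
Hypothesis k1 : exists2 y, y \in S & 0 < k y.

Lemma balance_lt a b X Y : (forall y, y \in S -> a - X y < b - Y y) ->
  balance a X < balance b Y.
Proof.
move=> H; have [y0 y0S ky0] := k1; rewrite /balance (bigD1 y0)//= [ltRHS](bigD1 y0)//=.
apply: ltr_leD; first by rewrite ltr_pM2r//; apply: ltr_phi => //; exact: H.
apply: ler_sum => y /andP[yS _]; apply: ler_wpM2r; first exact: k0.
by apply: ler_phi => //; exact/ltW/H.
Qed.

Lemma balance_le a b X : a <= b -> balance a X <= balance b X.
Proof.
rewrite le_eqVlt => /predU1P[->//|ab].
by apply/ltW/balance_lt => y _; rewrite ltrD2r.
Qed.

(** Comparison principle for one boundary vertex. It gives uniqueness of the
root, the sign of the boundary values, and a Lipschitz bound. *)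
Lemma balance_root_le a b X Y (d : R) : balance a X = 0 -> balance b Y = 0 ->
  (forall y, y \in S -> X y <= Y y + d) -> a <= b + d.
Proof.
move=> aX bY XY; rewrite leNgt; apply/negP => bda.
have : balance b Y < balance a X.
  by apply: balance_lt => y yS; have := XY y yS; lra.
by rewrite aX bY ltxx.
Qed.

Lemma balance_root_ex X : exists c, balance c X = 0.
Proof.
apply: (@sum_root (fun y s => phi p s * k y) X) => y.
- move=> yS s; apply: cvgM; [exact: phi_continuous|exact: cvg_cst].
- by move=> s yS s0; rewrite mulr_ge0 ?phi_ge0// k0.
- by move=> s yS s0; rewrite mulr_le0_ge0 ?phi_le0// k0.
Qed.

(** The boundary value that the interior values force when sigma = 0. *)
Definition balance_root X : R := xget 0 [set c | balance c X = 0].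

Lemma balance_rootP X : balance (balance_root X) X = 0.
Proof. exact: (xgetPex 0 (balance_root_ex X)). Qed.

Lemma balance_root_unique X c : balance c X = 0 -> c = balance_root X.
Proof.
move=> cX; have rX := balance_rootP X.
have le0 c1 c2 : balance c1 X = 0 -> balance c2 X = 0 -> c1 <= c2.
  move=> h1 h2; rewrite -[c2]addr0.
  by apply: (balance_root_le h1 h2) => y _; rewrite addr0.
by apply/eqP; rewrite eq_le !le0.
Qed.

Lemma balance_root_dist X Y (d : R) : (forall y, y \in S -> `|X y - Y y| <= d) ->
  `|balance_root X - balance_root Y| <= d.
Proof.
move=> XY; rewrite ler_norml; apply/andP; split.
  have : balance_root Y <= balance_root X + d; last by lra.
  apply: (balance_root_le (balance_rootP Y) (balance_rootP X)) => y yS.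
  by have := XY y yS; rewrite ler_norml => /andP[]; lra.
have : balance_root X <= balance_root Y + d; last by lra.
apply: (balance_root_le (balance_rootP X) (balance_rootP Y)) => y yS.
by have := XY y yS; rewrite ler_norml => /andP[]; lra.
Qed.
End Balance.

(** * Differentiability of the balanced value along curves *)

(** The balanced value is in general not a differentiable function of the
interior values, but it is differentiable along every differentiable curve. With
[a y = z t - X t y], insert the trial line [z t + h * c] into the balance at time
[h + t] and divide by a normalisation [nrm h] of the sign of [h]: the limit at
h = 0 is [\sum_y g y (c - D y)], strictly increasing in [c]. If D0 is its root,
then for c > D0 and c < D0 the balance on the trial line has opposite strict
signs, which traps [(z (h + t) - z t) / h] near D0. Which normalisation works
depends on the size of [phi p h] against [h]:
- if p < 2 and some [a y] vanishes, or if all of them vanish, then [nrm] is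
  [phi p], and only the terms with [a y = 0] contribute to the limit;
- otherwise all terms are differentiable and [nrm] is the identity. *)
Section BalanceCurve.
Context {R : realType} {V : finType} (S : {set V}) (p : R) (k : V -> R).
Hypothesis p1 : 1 < p.
Hypothesis k0 : forall y, y \in S -> 0 <= k y.
Hypothesis k1 : exists2 y, y \in S & 0 < k y.
Variables (X : R -> V -> R) (z : R -> R) (t : R).
Hypothesis dX : forall y, y \in S -> derivable (X ^~ y) t 1.
Hypothesis zX : forall s, balance S p k (z s) (X s) = 0.

Let a y := z t - X t y.
Let D y := 'D_1 (X ^~ y) t.

Let line_derive c y : y \in S ->
  is_derive t (1 : R) (fun s => z t + (s - t) * c - X s y) (c - D y).
Proof.
move=> yS.
have h1 : is_derive t (1 : R) (fun s : R => s - t) (1 - 0) by exact: is_deriveB.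
have h2 := is_deriveB (is_deriveD (is_derive_cst (z t) t (1 : R)) (is_deriveZ c h1))
  (derivableP (dX yS)).
rewrite (_ : (fun s => _) = cst (z t) + c \*: (fun s : R => s - t) - X ^~ y).
  by apply: (is_derive_eq h2); rewrite subr0 add0r [_ *: _]mulr1.
by apply/funext => s; rewrite -[X in _ = X - _]/(z t + c * (s - t)) (mulrC c).
Qed.

Let quot_cvg c y : y \in S ->
  (z t + h * c - X (h + t) y - a y) / h @[h --> 0^'] --> c - D y.
Proof.
move=> yS; have /is_derive1P := @line_derive c y yS.
by under eq_fun do rewrite addrK subrr mul0r addr0.
Qed.

Let smooth_cvg c y : y \in S -> a y != 0 \/ 2 <= p ->
  (phi p (z t + h * c - X (h + t) y) - phi p (a y)) / h @[h --> 0^']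
    --> 'D_1 (phi p) (a y) * (c - D y).
Proof.
move=> yS ay; have hl := @line_derive c y yS.
have hp : is_derive ((fun s => z t + (s - t) * c - X s y) t) (1 : R) (phi p) ('D_1 (phi p) (a y)).
  by rewrite /= subrr mul0r addr0; exact: is_derive_phi.
have /is_derive1P := @is_derive1_comp R (phi p)
  (fun s => z t + (s - t) * c - X s y) t _ _ hp hl.
by rewrite /comp; under eq_fun do rewrite addrK subrr mul0r addr0.
Qed.

Let homog_cvg c y : y \in S -> a y = 0 ->
  phi p (z t + h * c - X (h + t) y) / phi p h @[h --> 0^'] --> phi p (c - D y).
Proof.
move=> yS ay.
have := cvg_comp _ _ (@quot_cvg c y yS) (phi_continuous p1 (x:=c - D y)).
apply: cvg_trans; apply: near_eq_cvg; near=> h.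
have h0 : h != 0 by near: h; exact: nbhs_dnbhs_neq.
rewrite /= ay subr0 phiM; congr (_ * _).
apply: (mulfI (x := phi p h)); first by rewrite phi_eq0.
by rewrite divff ?phi_eq0// -phiM divff// /phi normr1 powR1 mulr1.
Unshelve. all: by end_near. Qed.

Let flat_cvg c y : y \in S -> a y != 0 -> p < 2 ->
  (phi p (z t + h * c - X (h + t) y) - phi p (a y)) / phi p h @[h --> 0^'] --> 0.
Proof.
move=> yS ay p2.
have h2 : {for 0, continuous (fun x : R => `|x| `^ (2 - p))}.
  by apply: norm_powR_continuous; rewrite subr_ge0 ltW.
have {}h2 : `|h| `^ (2 - p) @[h --> (0 : R)^'] --> (0 : R).
  move/continuous_withinNx : h2; rewrite normr0 powR0//.
  by rewrite subr_eq0 gt_eqF.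
rewrite -[X in _ --> X](mulr0 ('D_1 (phi p) (a y) * (c - D y))).
have := cvgM (@smooth_cvg c y yS (or_introl ay)) h2.
move=> cM; apply: (cvg_trans _ (cM _)); apply: near_eq_cvg; near=> h.
have h0 : h != 0 by near: h; exact: nbhs_dnbhs_neq.
rewrite /= -[LHS]mulrA; congr (_ * _).
rewrite /phi -opprB powRN [RHS]invfM mulrC.
by rewrite -[p - 2]opprB powRN.
Unshelve. all: by end_near. Qed.

Let derivable_of_limit (nrm : R -> R) (g : V -> R -> R) :
  (forall h, 0 < h -> 0 < nrm h) -> (forall h, h < 0 -> nrm h < 0) ->
  (forall y, y \in S -> continuous (g y)) -> (forall y, y \in S -> g y 0 = 0) ->
  (forall y, y \in S -> {homo g y : s s' / s <= s'}) ->
  (exists2 y, y \in S & {homo g y : s s' / s < s'}) ->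
  (forall c y, y \in S ->
    (phi p (z t + h * c - X (h + t) y) - phi p (a y)) / nrm h * k y @[h --> 0^']
    --> g y (c - D y)) ->
  derivable z t 1.
Proof.
move=> np nn gc g0 gm gs lim.
have [D0 HD0] : exists c, \sum_(y in S) g y (c - D y) = 0.
  apply: sum_root => // y s yS s0; first by rewrite -(g0 y yS); exact: gm.
  by rewrite -[leRHS](g0 y yS); exact: gm.
have L c : balance S p k (z t + h * c) (X (h + t)) / nrm h @[h --> 0^']
    --> \sum_(y in S) g y (c - D y).
  have -> : (fun h => balance S p k (z t + h * c) (X (h + t)) / nrm h) =
      (fun h => \sum_(y in S)
        (phi p (z t + h * c - X (h + t) y) - phi p (a y)) / nrm h * k y).
    apply/funext => h; rewrite -[balance _ _ _ _ _]subr0 -[X in _ - X](zX t).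
    rewrite /balance -sumrB mulr_suml; apply: eq_bigr => y _; rewrite /a; ring.
  by apply: cvg_sum_in => y yS; exact: lim.
suff /is_derive1P[] : (z (h + t) - z t) / h @[h --> 0^'] --> D0 by [].
apply/cvgrPdistC_le => eta eta0.
have Lp : 0 < \sum_(y in S) g y (D0 + eta - D y).
  by rewrite -[ltLHS]HD0; apply: (sum_strict D gm gs); rewrite ltrDl.
have Lm : \sum_(y in S) g y (D0 - eta - D y) < 0.
  by rewrite -[ltRHS]HD0; apply: (sum_strict D gm gs); rewrite gtrDl oppr_lt0.
have Np0 : \forall h \near (0:R)^',
    0 < balance S p k (z t + h * (D0 + eta)) (X (h + t)) / nrm h.
  exact: (cvgr_gt _ (L (D0 + eta)) _ Lp).
have Nm0 : \forall h \near (0:R)^',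
    balance S p k (z t + h * (D0 - eta)) (X (h + t)) / nrm h < 0.
  exact: (cvgr_lt _ (L (D0 - eta)) _ Lm).
near=> h.
have h0 : h != 0 by near: h; exact: nbhs_dnbhs_neq.
have Np : 0 < balance S p k (z t + h * (D0 + eta)) (X (h + t)) / nrm h by near: h.
have Nm : balance S p k (z t + h * (D0 - eta)) (X (h + t)) / nrm h < 0 by near: h.
have zh := zX (h + t).
have mono c c' : balance S p k c (X (h + t)) < balance S p k c' (X (h + t)) -> c < c'.
  by move=> cc; rewrite ltNge; apply: contraTN cc => cc; rewrite -leNgt; exact: balance_le.
have [hp|hn|/eqP] := ltgtP 0 h; last by rewrite eq_sym (negPf h0).
- move: Np Nm; rewrite pmulr_lgt0 ?invr_gt0 ?np// pmulr_llt0 ?invr_gt0 ?np//.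
  rewrite -zh => /mono h1 /mono h2.
  rewrite ler_distl ler_pdivlMr// ler_pdivrMr//; lra.
- move: Np Nm; rewrite nmulr_lgt0 ?invr_lt0 ?nn// nmulr_llt0 ?invr_lt0 ?nn//.
  rewrite -zh => /mono h1 /mono h2.
  rewrite ler_distl ler_ndivlMr// ler_ndivrMr//; lra.
Unshelve. all: by end_near. Qed.

Lemma balance_root_derivable : derivable z t 1.
Proof.
have [[y1 [y1S ky1 ay1 hsing]]|nsing] := pselect (exists y, [/\ y \in S, 0 < k y, a y = 0 &
    p < 2 \/ forall y, y \in S -> 0 < k y -> a y = 0]).
  (* The degenerate terms dominate: g y is phi at the vertices with a y = 0. *)
  apply: (@derivable_of_limit (phi p) (fun y s => (a y == 0)%:R * phi p s * k y)).
  - exact: phi_gt0.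
  - by move=> h h0; rewrite -oppr_gt0 -phiN phi_gt0// oppr_gt0.
  - move=> y yS s; apply: cvgM; last exact: cvg_cst.
    by apply: cvgM; [exact: cvg_cst|exact: phi_continuous].
  - by move=> y yS; rewrite phi0 mulr0 mul0r.
  - move=> y yS s s' ss'; apply: ler_wpM2r; first exact: k0.
    by apply: ler_wpM2l; [exact: ler0n|exact: ler_phi].
  - by exists y1 => // s s' ss'; rewrite ay1 eqxx !mul1r ltr_pM2r//; exact: ltr_phi.
  - move=> c y yS; have [ay|ay] := eqVneq (a y) 0.
      rewrite ay phi0 mul1r; under eq_fun do rewrite subr0.
      by apply: cvgM; [exact: homog_cvg|exact: cvg_cst].
    rewrite !mul0r; have := k0 yS; rewrite le_eqVlt => /predU1P[<-|ky].
      by under eq_fun do rewrite mulr0; exact: cvg_cst.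
    rewrite -[X in _ --> X](mul0r (k y)); apply: cvgM; last exact: cvg_cst.
    apply: flat_cvg => //; case: hsing => // /(_ y yS ky) ay'.
    by rewrite ay' eqxx in ay.
have [y1 [y1S ky1 ay1]] : exists y, [/\ y \in S, 0 < k y & a y != 0].
  have [y0 y0S ky0] := k1; apply: contrapT => H.
  have H' y : y \in S -> 0 < k y -> a y = 0.
    by move=> yS ky; apply/eqP/negPn/negP => ay; apply: H; exists y.
  by apply: nsing; exists y0; split => //; [exact: H'|right].
have smooth y : y \in S -> 0 < k y -> a y != 0 \/ 2 <= p.
  move=> yS ky; have [p2|p2] := leP 2 p; first by right.
  by left; apply/eqP => ay; apply: nsing; exists y; split => //; left.
(* All relevant terms are differentiable: g y is the linearised flux. *)
apply: (@derivable_of_limit id (fun y s => 'D_1 (phi p) (a y) * s * k y)) => //.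
- by move=> y yS s; apply: cvgM; [apply: cvgM; [exact: cvg_cst|exact: cvg_id]|exact: cvg_cst].
- by move=> y yS; rewrite mulr0 mul0r.
- move=> y yS s s' ss'; have := k0 yS; rewrite le_eqVlt => /predU1P[<-|ky].
    by rewrite !mulr0.
  by rewrite ler_pM2r// ler_wpM2l// derive_phi_ge0//; exact: smooth.
- exists y1 => // s s' ss'.
  by rewrite ltr_pM2r// ltr_pM2l// derive_phi_gt0.
- move=> c y yS; have := k0 yS; rewrite le_eqVlt => /predU1P[<-|ky].
    by rewrite mulr0; under eq_fun do rewrite mulr0; exact: cvg_cst.
  by apply: cvgM; [apply: smooth_cvg => //; exact: smooth|exact: cvg_cst].
Qed.
End BalanceCurve.

(** * Energy inequality on the network *)

Section Network.
Context {R : realType} {V : finType} (e : rel V) (w : V -> V -> R) (S : {set V}).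
Variable p : R.
Hypothesis hG : is_network e w.
Implicit Types (f : V -> R) (x y z : V).

Lemma cut_weight_sym x y : cut_weight S w x y = cut_weight S w y x.
Proof. by rewrite /cut_weight orbC (weight_sym hG). Qed.

Lemma cut_weight_ge0 x y : 0 <= cut_weight S w x y.
Proof. by rewrite /cut_weight; case: ifP => // _; exact: weight_ge0 hG _ _. Qed.

Lemma mem_gclosure x : x \in S -> x \in gclosure e S.
Proof. by move=> xS; rewrite /gclosure finset.in_setU xS. Qed.

Lemma boundary_notin z : z \in boundary e S -> z \notin S.
Proof. by rewrite inE => /andP[]. Qed.

Lemma boundary_weight z : z \in boundary e S ->
  exists2 y, y \in S & 0 < cut_weight S w z y.
Proof.
rewrite inE => /andP[_ /existsP[y /andP[yS eyz]]]; exists y => //.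
by rewrite cut_weight_sym /cut_weight yS; apply/(weight_gt0 hG).
Qed.

Lemma plaplacianE f x : plaplacian e S w p f x =
  \sum_(y in gclosure e S) phi p (f y - f x) * cut_weight S w x y.
Proof. by apply: eq_bigr => y _; rewrite distrC. Qed.

Lemma pnormalE f z : pnormal S w p f z = balance S p (cut_weight S w z) (f z) f.
Proof. by []. Qed.

Lemma plaplacian_boundary f z : z \in boundary e S ->
  plaplacian e S w p f z = - pnormal S w p f z.
Proof.
move=> zB; have zS := boundary_notin zB.
rewrite plaplacianE pnormalE /balance -sumrN big_mkcond [RHS]big_mkcond/=.
apply: eq_bigr => y _; have [yS|yS] := boolP (y \in S).
  by rewrite mem_gclosure// -opprB phiN mulNr.
by case: ifP => // _; rewrite /cut_weight (negPf yS) (negPf zS) mulr0.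
Qed.


(** The summand [phi p (f y - f x) * cut_weight S w x y] is antisymmetric in
[x] and [y]; symmetrising the double sum leaves [psi (f x) - psi (f y)] times a
quantity of the opposite sign. *)
Lemma energy_le0 f (psi : R -> R) : {homo psi : a b / a <= b} ->
  \sum_(x in gclosure e S) psi (f x) * plaplacian e S w p f x <= 0.
Proof.
move=> psi_m; set T := \sum_(x in _) _.
pose A x y := phi p (f y - f x) * cut_weight S w x y.
have AN x y : A y x = - A x y.
  by rewrite /A -opprB phiN mulNr cut_weight_sym.
have T1 : T = \sum_(x in gclosure e S) \sum_(y in gclosure e S) psi (f x) * A x y.
  by apply: eq_bigr => x _; rewrite plaplacianE mulr_sumr.
have T2 : T = \sum_(x in gclosure e S) \sum_(y in gclosure e S) - (psi (f y) * A x y).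
  rewrite T1 exchange_big; apply: eq_bigr => x _; apply: eq_bigr => y _.
  by rewrite AN mulrN.
have : T + T <= 0; last by lra.
rewrite {1}T1 T2 -big_split; apply: sumr_le0 => x _.
rewrite -big_split; apply: sumr_le0 => y _ /=.
rewrite -mulrBl /A mulrA; apply: mulr_le0_ge0; last exact: cut_weight_ge0.
have [fxy|/ltW fxy] := leP (f x) (f y).
  by apply: mulr_le0_ge0; rewrite ?subr_le0 ?psi_m// phi_ge0// subr_ge0.
by apply: mulr_ge0_le0; rewrite ?subr_ge0 ?psi_m// phi_le0// subr_le0.
Qed.

(** Zero flux at the boundary vertices is what allows summing over [S] only. *)
Lemma energy_interior_le0 f (psi : R -> R) :
  (forall z, z \in boundary e S -> pnormal S w p f z = 0) ->
  {homo psi : a b / a <= b} ->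
  \sum_(x in S) psi (f x) * plaplacian e S w p f x <= 0.
Proof.
move=> fB psi_m; apply: le_trans (energy_le0 f psi_m).
rewrite le_eqVlt; apply/orP; left; apply/eqP.
rewrite big_mkcond [RHS]big_mkcond/=; apply: eq_bigr => x _.
have [xS|xS] := boolP (x \in S); first by rewrite mem_gclosure.
case: ifP => //; rewrite inE (negPf xS)/= => xB.
by rewrite plaplacian_boundary// fB// oppr0 mulr0.
Qed.

(** The constants 1 and -1 are both nondecreasing. *)
Lemma sum_plaplacian f :
  (forall z, z \in boundary e S -> pnormal S w p f z = 0) ->
  \sum_(x in S) plaplacian e S w p f x = 0.
Proof.
move=> fB; apply/eqP; rewrite eq_le; apply/andP; split.
  have := @energy_interior_le0 f (fun=> 1) fB (fun _ _ _ => lexx _).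
  by under eq_bigr do rewrite mul1r.
have := @energy_interior_le0 f (fun=> -1) fB (fun _ _ _ => lexx _).
by under eq_bigr do rewrite mulN1r; rewrite sumrN oppr_le0.
Qed.

End Network.

(** * Differential inequalities *)

Section Calculus.
Context {R : realType}.
Implicit Types (f df : R -> R) (a b t k : R).

Lemma derive_le0_le f df a b : a <= b ->
  (forall t, a <= t <= b -> is_derive t (1 : R) f (df t)) ->
  (forall t, a <= t <= b -> df t <= 0) -> f b <= f a.
Proof.
move=> ab fd df0; apply: (@ler0_derive1_nincr R f a b) => //.
- move=> t; rewrite in_itv /= => /andP[at_ tb].
  by have [] : is_derive t (1 : R) f (df t) by apply: fd; rewrite !ltW.
- move=> t; rewrite in_itv /= => /andP[at_ tb].
  have h : is_derive t (1 : R) f (df t) by apply: fd; rewrite !ltW.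
  by rewrite derive1E derive_val df0// !ltW.
- apply: derivable_within_continuous => t; rewrite in_itv/= => tab.
  by have [] := fd t tab.
Qed.

Lemma derive_le0_le_right f df b : 0 < b -> f t @[t --> 0^'+] --> f 0 ->
  (forall t, 0 < t <= b -> is_derive t (1 : R) f (df t)) ->
  (forall t, 0 < t <= b -> df t <= 0) -> f b <= f 0.
Proof.
move=> b0 f0 fd df0; apply: (cvgr_to_ge f0); near=> s.
have s0 : 0 < s by near: s; exact: nbhs_right_gt.
have sb : s <= b by near: s; exact: nbhs_right_le.
have pos t : s <= t <= b -> 0 < t <= b.
  by move=> /andP[st ->]; rewrite (lt_le_trans s0 st).
by apply: (@derive_le0_le f df) => // t /pos; [exact: fd|exact: df0].
Unshelve. all: by end_near. Qed.

Lemma is_derive_expRM k t :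
  is_derive t (1 : R) (fun s => expR (k * s)) (expR (k * t) * k).
Proof.
have h : is_derive t (1 : R) (fun s => k * s) k.
  rewrite -[X in is_derive _ _ _ X]mulr1.
  exact: (@is_deriveZ _ _ _ (@id R) k t 1 1).
exact: (@is_derive1_comp R expR (fun s => k * s) t _ _ (is_derive_expR _) h).
Qed.

Lemma gronwall f df k b : 0 < b -> f t @[t --> 0^'+] --> f 0 ->
  (forall t, 0 < t <= b -> is_derive t (1 : R) f (df t)) ->
  (forall t, 0 < t <= b -> df t <= k * f t) -> f b <= f 0 * expR (k * b).
Proof.
move=> b0 f0 fd dfk.
have H : f b * expR (- k * b) <= f 0 * expR (- k * 0).
  apply: (@derive_le0_le_right (fun s => f s * expR (- k * s))
      (fun s => f s * (expR (- k * s) * - k) + expR (- k * s) * df s)) => //.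
  - apply: cvgM => //; apply: cvg_at_right_filter.
    apply: (@continuous_comp _ _ _ (fun s => - k * s) expR); last exact: continuous_expR.
    by apply: cvgM; [exact: cvg_cst|exact: cvg_id].
  - by move=> t tb; apply: is_deriveM; [exact: fd|exact: is_derive_expRM].
  - move=> t tb; rewrite mulrCA -mulrDr pmulr_rle0 ?expR_gt0//.
    by have := dfk t tb; lra.
move: H; rewrite mulr0 expR0 mulr1 mulNr expRN.
by rewrite ler_pdivrMr ?expR_gt0.
Qed.

(** A differentiable function that vanishes exactly on the nonnegative reals;
its derivative is nondecreasing, as [energy_interior_le0] requires. *)
Definition sqneg (a : R) : R := Num.min a 0 ^+ 2.

Lemma is_derive_sqneg a : is_derive a (1 : R) sqneg (2 * Num.min a 0).
Proof.
apply: is_derive_slope => eta eta0; exists eta => // s sa.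
apply: (@le_trans _ _ (`|s - a| ^+ 2)); last first.
  by rewrite expr2 ler_wpM2r// ltW.
rewrite real_normK ?num_real// /sqneg ler_norml.
have [a0|a0] := leP a 0; have [s0|s0] := leP s 0; apply/andP; split; rewrite !expr2.
- by have := sqr_ge0 (s - a); rewrite expr2; lra.
- by lra.
- by have := mulr_le0_ge0 a0 (ltW s0); have := sqr_ge0 s; have := sqr_ge0 a; rewrite !expr2; lra.
- by have := sqr_ge0 s; rewrite expr2; lra.
- by have := sqr_ge0 (s - a); have := sqr_ge0 s; rewrite !expr2; lra.
- by have := mulr_le0_ge0 s0 (ltW a0); have := sqr_ge0 a; rewrite !expr2; lra.
- by have := sqr_ge0 (s - a); rewrite !expr2; lra.
- by have := sqr_ge0 (s - a); rewrite !expr2; lra.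
Qed.

End Calculus.

(** The left derivative at the endpoint is the limit of the derivatives: apply the
mean value inequality on [s, s'] and let s' tend to [r]. *)
Lemma left_slope (R : realType) (f df : R -> R) (r l D : R) : 0 < r ->
  (forall t, 0 < t < r -> is_derive t (1 : R) f (df t)) ->
  f t @[t --> r^'-] --> l -> df t @[t --> r^'-] --> D ->
  forall eta, 0 < eta -> exists2 rho, 0 < rho & forall s, `|s - r| < rho -> s < r ->
    `|f s - l - (s - r) * D| <= eta * `|s - r|.
Proof.
move=> r0 fd fl dfD eta eta0.
have [d /= d0 Hd] : \forall t \near r^'-, `|df t - D| < eta.
  by move/cvgrPdistC_lt : dfD; exact.
exists (Num.min d r); first by rewrite lt_min d0.
move=> s; rewrite lt_min => /andP[sd s_r] sr.
have s0 : 0 < s by move: s_r; rewrite ltr_norml; lra.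
have inside t : s <= t -> t < r -> 0 < t < r /\ `|df t - D| <= eta.
  move=> st tr; split; first by rewrite tr (lt_le_trans s0 st).
  apply/ltW/Hd => //=; apply: le_lt_trans sd.
  by rewrite distrC !ler0_norm ?subr_le0 ?(ltW sr) ?(ltW tr)//; lra.
have lin c t : is_derive t (1 : R) (fun s : R => c * s) (c * 1).
  exact: (@is_deriveZ _ _ _ (@id R) c t 1 1).
have bnd s' : s <= s' -> s' < r ->
    f s' - f s <= (D + eta) * (s' - s) /\ (D - eta) * (s' - s) <= f s' - f s.
  move=> ss' s'r; split.
    have := @derive_le0_le R (fun t => f t - (D + eta) * t)
      (fun t => df t - (D + eta) * 1) s s' ss'.
    have H : f s' - (D + eta) * s' <= f s - (D + eta) * s ->
        f s' - f s <= (D + eta) * (s' - s) by lra.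
    move=> h; apply: H; apply: h => t /andP[st ts'].
      apply: is_deriveB => //; apply: fd.
      by have [] := inside t st (le_lt_trans ts' s'r).
    by have [_] := inside t st (le_lt_trans ts' s'r); rewrite ler_norml mulr1; lra.
  have := @derive_le0_le R (fun t => (D - eta) * t - f t)
    (fun t => (D - eta) * 1 - df t) s s' ss'.
  have H : (D - eta) * s' - f s' <= (D - eta) * s - f s ->
      (D - eta) * (s' - s) <= f s' - f s by lra.
  move=> h; apply: H; apply: h => t /andP[st ts'].
    apply: is_deriveB => //; apply: fd.
    by have [] := inside t st (le_lt_trans ts' s'r).
  by have [_] := inside t st (le_lt_trans ts' s'r); rewrite ler_norml mulr1; lra.
have near_s : \forall t \near r^'-, s <= t /\ t < r.
  near=> t; split; first by near: t; exact: nbhs_left_ge.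
  by near: t; exact: nbhs_left_lt.
have cs : t - s @[t --> r^'-] --> r - s.
  by apply: cvgB; [apply: cvg_at_left_filter; exact: cvg_id|exact: cvg_cst].
have cf : f t - f s @[t --> r^'-] --> l - f s by apply: cvgB => //; exact: cvg_cst.
have h1 : l - f s <= (D + eta) * (r - s).
  apply: (ler_cvg_to cf (cvgM (cvg_cst _) cs)).
  by apply: filterS near_s => t [h h']; have [] := bnd t h h'.
have h2 : (D - eta) * (r - s) <= l - f s.
  apply: (ler_cvg_to (cvgM (cvg_cst _) cs) cf).
  by apply: filterS near_s => t [h h']; have [] := bnd t h h'.
by rewrite ler_norml (ltr0_norm (x := s - r)) ?subr_lt0//; apply/andP; split; lra.
Unshelve. all: by end_near. Qed.

(** * Oscillation before a finite time *)

(** A function that can decrease only at a rate controlled by its own size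
cannot oscillate forever before time [r]: [theta = (1 + f) `^ (- p)] has derivative
at most [p * W], so [theta t - p * W * t] is monotone and [theta] has a limit. The
limit is 0 exactly when [f] tends to infinity. *)
Lemma blowup_or_limit (R : realType) (p r W : R) (f df : R -> R) :
  1 < p -> 0 < r -> 0 <= W ->
  (forall t, 0 < t < r -> is_derive t (1 : R) f (df t)) ->
  (forall t, 0 < t < r -> 0 <= f t) ->
  (forall t, 0 < t < r -> - W * phi p (f t) <= df t) ->
  f t @[t --> r^'-] --> +oo \/ exists l : R, f t @[t --> r^'-] --> l.
Proof.
move=> p1 r0 W0 fd f0 dfW.
have p0 : 0 < p by rewrite (lt_trans ltr01).
pose theta t := (1 + f t) `^ (- p).
have f1 t : 0 < t < r -> 0 < 1 + f t by move=> /f0 ft; rewrite ltr_pwDl.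
have f1' t : 0 < t < r -> 1 <= 1 + f t by move=> /f0 ft; rewrite lerDl.
have theta_gt0 t : 0 < t < r -> 0 < theta t by move=> /f1 ft; rewrite powR_gt0.
have dtheta t : 0 < t < r ->
    is_derive t (1 : R) theta (- p * (1 + f t) `^ (- p - 1) * df t).
  move=> tr; have h : is_derive t (1 : R) (fun s => 1 + f s) (df t).
    by rewrite -[X in is_derive _ _ _ X]add0r; apply: is_deriveD; exact: fd.
  exact: (@is_derive1_comp R (fun a => a `^ (- p)) (fun s => 1 + f s) t _ _
    (is_derive1_powR _ (f1 t tr)) h).
have dtheta_le t : 0 < t < r -> - p * (1 + f t) `^ (- p - 1) * df t <= p * W.
  move=> tr; rewrite !mulNr -mulrN -mulrA ler_pM2l//.
  have h1 : - df t <= W * phi p (f t) by have := dfW t tr; lra.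
  apply: (@le_trans _ _ ((1 + f t) `^ (- p - 1) * (W * phi p (f t)))).
    by rewrite ler_wpM2l// powR_ge0.
  rewrite mulrCA -[leRHS]mulr1 ler_wpM2l//.
  have h2 : phi p (f t) <= (1 + f t) `^ (p - 1).
    by rewrite -phiE ?f1//; apply: ler_phi => //; rewrite lerDr.
  apply: (@le_trans _ _ ((1 + f t) `^ (- p - 1) * (1 + f t) `^ (p - 1))).
    by rewrite ler_wpM2l// powR_ge0.
  rewrite -powRD; last by rewrite (gt_eqF (f1 t tr)) implybT.
  rewrite -[leRHS](powRr0 (1 + f t)); apply: ler_powR; first exact: f1'.
  by lra.
pose g t := p * W * t - theta t.
have g_m : {in `]0, r[ &, {homo g : s t / s <= t}}.
  move=> s t; rewrite !in_itv/= => /andP[s0 sr] /andP[t0 tr] st.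
  have pos s' : s <= s' <= t -> 0 < s' < r.
    by move=> /andP[h1 h2]; rewrite (lt_le_trans s0 h1) (le_lt_trans h2 tr).
  rewrite -lerN2.
  apply: (@derive_le0_le R (fun s => - g s) (fun s =>
    - (p * W * 1 - (- p * (1 + f s) `^ (- p - 1) * df s))) s t st) => s' /pos hs'.
    have h : is_derive s' (1 : R) (fun s => p * W * s) (p * W * 1).
      exact: (@is_deriveZ _ _ _ (@id R) (p * W) s' 1 1).
    exact: (is_deriveN (is_deriveB h (dtheta s' hs'))).
  by have := dtheta_le s' hs'; lra.
have [Lg cg] : exists l : R, g t @[t --> r^'-] --> l.
  apply/cvg_ex; apply: nondecreasing_at_left_is_cvgr.
    near=> x; move=> s t sx tx; apply: g_m.
      have x0 : 0 < x by near: x; exact: nbhs_left_gt.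
      by move: sx; rewrite !in_itv/= => /andP[xs ->]; rewrite (lt_trans x0 xs).
    have x0 : 0 < x by near: x; exact: nbhs_left_gt.
    by move: tx; rewrite !in_itv/= => /andP[xs ->]; rewrite (lt_trans x0 xs).
  near=> x; exists (p * W * r) => _ [t /= + <-]; rewrite in_itv/= => /andP[xt tr].
  have x0 : 0 < x by near: x; exact: nbhs_left_gt.
  have t0 : 0 < t < r by rewrite (lt_trans x0 xt).
  rewrite /g lerBlDr; apply: (@le_trans _ _ (p * W * r)).
    by rewrite ler_wpM2l ?mulr_ge0// ltW.
  by rewrite lerDl ltW// theta_gt0.
have near_tr : \forall t \near r^'-, 0 < t < r.
  near=> t; apply/andP; split; first by near: t; exact: nbhs_left_gt.
  by near: t; exact: nbhs_left_lt.
have [L cL] : exists L : R, theta t @[t --> r^'-] --> L.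
  exists (p * W * r - Lg).
  rewrite (_ : theta = fun t => p * W * t - g t); last first.
    by apply/funext => t; rewrite /g; ring.
  apply: cvgB => //; apply: cvgM; first exact: cvg_cst.
  by apply: cvg_at_left_filter; exact: cvg_id.
have L0 : 0 <= L.
  by apply: (cvgr_to_ge cL); apply: filterS near_tr => t /theta_gt0/ltW.
move: L0; rewrite le_eqVlt => /predU1P[L0|L0].
  left; apply/cvgryPge => A; rewrite -L0 in cL.
  have B0 : 0 < 1 + `|A| by rewrite ltr_pwDl.
  have small : \forall t \near r^'-, theta t < (1 + `|A|) `^ (- p).
    by apply: (cvgr_lt _ cL); rewrite powR_gt0.
  near=> t.
  have tr : 0 < t < r by near: t.
  have ts : theta t < (1 + `|A|) `^ (- p) by near: t.
  rewrite (le_trans (ler_norm A))// -(lerD2l 1) leNgt; apply/negP => fA.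
  move: ts; rewrite /theta !powRN ltf_pV2 ?posrE ?powR_gt0 ?f1//.
  have tr1 := f1 t tr.
  by rewrite ltNge ge0_ler_powR ?nnegrE ?(ltW p0) ?(ltW B0) ?(ltW fA) ?(ltW tr1).
(* f is recovered from theta by the inverse power. *)
right; exists (L `^ (- p^-1) - 1).
have cp : (theta t) `^ (- p^-1) @[t --> r^'-] --> L `^ (- p^-1).
  have [/derivable1_diffP/differentiable_continuous h _] := is_derive1_powR (- p^-1) L0.
  exact: (cvg_comp _ _ cL h).
have cf : (theta t) `^ (- p^-1) - 1 @[t --> r^'-] --> L `^ (- p^-1) - 1.
  by apply: cvgB cp (cvg_cst _).
apply: (cvg_trans _ cf); apply: near_eq_cvg; near=> t.
have tr : 0 < t < r by near: t.
rewrite /theta -powRrM mulrNN divff ?gt_eqF// powRr1 ?ltW ?f1//.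
by rewrite addrAC subrr add0r.
Unshelve. all: by end_near. Qed.

(** * A priori estimates for solutions *)

Lemma near_ereal_lt (R : realType) (T : \bar R) (t : R) : (t%:E < T)%E ->
  \forall s \near t, (s%:E < T)%E.
Proof.
case: T => [r| |] //; last by move=> _; apply: filterE => s; exact: ltry.
by rewrite lte_fin => tr; near=> s; rewrite lte_fin; near: s; exact: lt_nbhsl.
Unshelve. all: by end_near. Qed.

Section Solution.
Context {R : realType} {V : finType} (e : rel V) (w : V -> V -> R) (S : {set V}).
Context {mu sigma : V -> R} {p q lambda : R} {u0 : V -> R} {T : \bar R} {u : V -> R -> R}.
Hypotheses (hG : is_network e w) (p1 : 1 < p) (T0 : (0 < T)%E).
Hypothesis mu_gt0 : forall z, z \in boundary e S -> 0 < mu z.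
Hypothesis sigma0 : forall z, z \in boundary e S -> sigma z = 0.
Hypothesis usol : solves e S w p q lambda mu sigma u0 T u.

Let react (a : R) := lambda * (`|a| `^ (q - 1) * a).
Let rhs x t := plaplacian e S w p (u ^~ t) x + react (u x t).

Lemma sol_boundary z t : z \in boundary e S -> 0 <= t -> (t%:E < T)%E ->
  pnormal S w p (u ^~ t) z = 0.
Proof.
move=> zB t0 tT; have := solves_boundary usol zB t0 tT.
rewrite sigma0// mul0r addr0 => /eqP; rewrite mulf_eq0 gt_eqF ?mu_gt0//.
by move=> /eqP.
Qed.

Lemma sol_right x : x \in gclosure e S -> u x t @[t --> 0^'+] --> u x 0.
Proof.
move=> xS; have /subspace_continuousP/(_ 0) := solves_continuous usol xS.
move=> /(_ (conj (lexx 0) T0)) h U /h hU.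
have {}hU : \forall t \near (0 : R), 0 <= t /\ (t%:E < T)%E -> U (u x t) by exact: hU.
have hT : \forall s \near (0 : R), (s%:E < T)%E := near_ereal_lt T0.
suff : \forall t \near (0 : R), 0 < t -> U (u x t) by [].
by apply: filterS (filterI hU hT) => t [tU tT] t0; apply: tU; split; [exact: ltW|].
Qed.

Lemma sol_is_derive x t : x \in S -> 0 < t -> (t%:E < T)%E ->
  is_derive t (1 : R) (u x) (rhs x t).
Proof.
move=> xS t0 tT; have xc := mem_gclosure e xS.
apply: DeriveDef; first exact: (solves_derivable usol xc t0 tT).
by rewrite -derive1E (solves_equation usol xS t0 tT).
Qed.

Let before b : (b%:E < T)%E -> forall t, t <= b -> (t%:E < T)%E.
Proof. by move=> bT t tb; apply: le_lt_trans bT; rewrite lee_fin. Qed.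

Lemma sum_rhs t : 0 < t -> (t%:E < T)%E ->
  \sum_(x in S) rhs x t = lambda * \sum_(x in S) `|u x t| `^ (q - 1) * u x t.
Proof.
move=> t0 tT; rewrite big_split/= (sum_plaplacian hG).
  by rewrite add0r mulr_sumr.
by move=> z zB; apply: sol_boundary => //; exact: ltW.
Qed.

(** Testing the equation against [psi u] discards the diffusion. *)
Lemma sum_rhs_test_le t (psi : R -> R) : 0 < t -> (t%:E < T)%E ->
  {homo psi : a b / a <= b} ->
  \sum_(x in S) psi (u x t) * rhs x t <= \sum_(x in S) psi (u x t) * react (u x t).
Proof.
move=> t0 tT psi_m; under eq_bigr do rewrite mulrDr.
rewrite big_split/= gerDr; apply: energy_interior_le0 => // z zB.
by apply: sol_boundary => //; exact: ltW.
Qed.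

(** For q <= 1, [|a| ^ (q + 1) <= a ^ 2 + 1], hence the squared l2 norm grows at
most exponentially and no finite time is a blow-up time. *)
Lemma bounded_of_q_le1 (b : R) : 0 < lambda -> 0 < q -> q <= 1 -> 0 < b ->
  exists K, forall t x, x \in S -> 0 < t -> t <= b -> (t%:E < T)%E -> `|u x t| <= K.
Proof.
move=> l0 q0 q1 b0.
pose E t := \sum_(x in S) (u x t ^+ 2 + 1).
have E0 t : 0 <= E t by apply: sumr_ge0 => x _; rewrite addr_ge0// sqr_ge0.
have Ebound t : 0 < t -> t <= b -> (t%:E < T)%E -> E t <= E 0 * expR (2 * lambda * b).
  move=> t0 tb tT.
  apply: (@le_trans _ _ (E 0 * expR (2 * lambda * t))); last first.
    by rewrite ler_wpM2l// ler_expR ler_pM2l// mulr_gt0.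
  apply: (@gronwall R E (fun s => \sum_(x in S) (u x s + u x s) * rhs x s)) => //.
  - apply: cvg_sum_in => x xS; apply: cvgD; last exact: cvg_cst.
    by apply: cvgM; exact: sol_right (mem_gclosure e xS).
  - move=> s /andP[s0 st]; apply: is_derive_sum_in => x xS.
    have h := sol_is_derive xS s0 (before tT st).
    have := is_deriveD (is_deriveM h h) (is_derive_cst (1 : R) s (1 : R)).
    rewrite (_ : u x * u x + cst 1 = fun s => u x s ^+ 2 + 1); last first.
      by apply/funext => s'; rewrite expr2.
    by move=> h2; apply: (is_derive_eq h2); rewrite addr0 -mulrDl.
  - move=> s /andP[s0 st].
    have := @sum_rhs_test_le s (fun a => a + a) s0 (before tT st).
    move=> /(_ _)/le_trans; apply; first by move=> a a' aa; rewrite lerD.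
    rewrite mulr_sumr; apply: ler_sum => x xS.
    rewrite /react; set a := u x s.
    have ha : `|a| `^ (q - 1) * a * a <= a ^+ 2 + 1.
      have -> : `|a| `^ (q - 1) * a * a = `|a| `^ q * `|a|.
        rewrite -(mulr_powRB1 (normr_ge0 a) q0).
        by rewrite -mulrA -expr2 -(real_normK (num_real a)) expr2; ring.
      rewrite -(real_normK (num_real a)).
      have [a1|/ltW a1] := leP 1 `|a|.
        apply: (@le_trans _ _ (`|a| ^+ 2)); last by rewrite lerDl.
        by rewrite expr2 ler_wpM2r// ler1_powR.
      apply: (@le_trans _ _ 1); last by rewrite lerDr sqr_ge0.
      rewrite -[leRHS]mulr1; apply: ler_pM => //.
      have -> : (1 : R) = 1 `^ q by rewrite powR1.
      by apply: ge0_ler_powR; rewrite ?nnegrE ?powR1//; exact: ltW.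
    rewrite -[leRHS]/(2 * lambda * (a ^+ 2 + 1)).
    rewrite (_ : _ * _ = 2 * lambda * (`|a| `^ (q - 1) * a * a)); last by ring.
    by rewrite ler_pM2l// mulr_gt0.
exists (E 0 * expR (2 * lambda * b) + 1) => t x xS t0 tb tT.
apply: (le_trans _ (_ : E t + 1 <= _)); last by rewrite lerD2r Ebound.
apply: (@le_trans _ _ (u x t ^+ 2 + 1 + 1)).
  by rewrite -(real_normK (num_real (u x t))); have := sqr_ge0 (`|u x t| - 1); rewrite !expr2; nra.
rewrite lerD2r /E (bigD1 x)//= lerDl sumr_ge0// => y _.
by rewrite addr_ge0// sqr_ge0.
Qed.

Lemma bounded_before b : 0 < b -> (b%:E < T)%E ->
  exists2 K, 0 <= K & forall x t, x \in S -> 0 <= t <= b -> `|u x t| <= K.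
Proof.
move=> b0 bT.
have /choice[Kf HK] : forall x, exists K, x \in S -> forall t, 0 <= t <= b -> `|u x t| <= K.
  move=> x; have [xS|_] := boolP (x \in S); last by exists 0.
  have cx : {within `[0, b], continuous (u x)}.
    apply: continuous_subspaceW (solves_continuous usol (mem_gclosure e xS)).
    by move=> t /=; rewrite in_itv/= => /andP[t0 tb]; split => //; exact: before bT _ tb.
  have [c1 _ H1] := EVT_max (ltW b0) cx; have [c2 _ H2] := EVT_min (ltW b0) cx.
  exists (`|u x c1| + `|u x c2|) => _ t tb.
  have {}H1 := H1 t; have {}H2 := H2 t; rewrite in_itv/= tb in H1 H2.
  have := H1 isT; have := H2 isT.
  have := ler_norm (u x c1); have := ler_norm (- u x c2); rewrite normrN.
  have := normr_ge0 (u x c1); have := normr_ge0 (u x c2).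
  by rewrite ler_norml => *; apply/andP; split; lra.
exists (\sum_(x in S) `|Kf x|); first exact: sumr_ge0.
move=> x t xS tb; apply: (le_trans (HK x xS t tb)).
by rewrite (bigD1 x)//=; apply: (le_trans (ler_norm _)); rewrite lerDl sumr_ge0.
Qed.

Hypotheses (l0 : 0 < lambda) (u0_ge0 : forall x, x \in gclosure e S -> 0 <= u0 x).

(** The squared negative part starts at 0 and satisfies a linear differential
inequality: the reaction coefficient is at most [K ^ (q - 1)], where [K] bounds the
solution up to time [t]. *)
Lemma sol_ge0_interior x t : 1 < q -> x \in S -> 0 <= t -> (t%:E < T)%E -> 0 <= u x t.
Proof.
move=> q1 xS; rewrite le_eqVlt => /predU1P[<- _|t0 tT].
  by rewrite (solves_initial usol) ?u0_ge0// mem_gclosure.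
have [K K0 HK] := bounded_before t0 tT.
pose N s := \sum_(x in S) sqneg (u x s).
have N0 : N 0 = 0.
  apply: big1 => y yS; rewrite /sqneg (solves_initial usol) ?mem_gclosure//.
  by rewrite min_r ?expr0n// u0_ge0// mem_gclosure.
have : N t <= N 0 * expR (2 * lambda * K `^ (q - 1) * t).
  apply: (@gronwall R N (fun s => \sum_(x in S) (2 * Num.min (u x s) 0) * rhs x s)) => //.
  - apply: cvg_sum_in => y yS.
    apply: (cvg_comp _ _ (sol_right (mem_gclosure e yS))).
    have [/derivable1_diffP/differentiable_continuous h _] := is_derive_sqneg (u y 0).
    exact: h.
  - move=> s /andP[s0 st]; apply: is_derive_sum_in => y yS.
    exact: (is_derive1_comp (is_derive_sqneg _) (sol_is_derive yS s0 (before tT st))).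
  - move=> s /andP[s0 st].
    have := @sum_rhs_test_le s (fun a => 2 * Num.min a 0) s0 (before tT st).
    move=> /(_ _)/le_trans; apply.
      by move=> a a' aa; rewrite ler_pM2l// le_min2.
    rewrite mulr_sumr; apply: ler_sum => y yS.
    have Ky : `|u y s| <= K by apply: HK => //; rewrite st ltW.
    rewrite /react /sqneg; set a := u y s in Ky *.
    have am : a * Num.min a 0 = Num.min a 0 ^+ 2.
      by have [_|_] := leP a 0; rewrite ?mulr0 ?expr0n// expr2.
    rewrite (_ : _ * _ = 2 * lambda * `|a| `^ (q - 1) * (a * Num.min a 0)); last by ring.
    rewrite am ler_wpM2r ?sqr_ge0// ler_pM2l ?mulr_gt0//.
    apply: ge0_ler_powR; rewrite ?nnegrE// subr_ge0; exact: ltW.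
rewrite N0 mul0r => Nt.
have : sqneg (u x t) <= 0.
  apply: le_trans Nt; rewrite /N (bigD1 x)//= lerDl sumr_ge0// => y _.
  exact: sqr_ge0.
rewrite /sqneg; have [_|/ltW //] := leP (u x t) 0.
by rewrite real_exprn_even_le0 ?num_real//= => /eqP ->.
Qed.

Lemma sol_ge0 x t : 1 < q -> x \in gclosure e S -> 0 <= t -> (t%:E < T)%E -> 0 <= u x t.
Proof.
move=> q1; rewrite /gclosure finset.in_setU => /orP[xS|xB] t0 tT; first exact: sol_ge0_interior.
have ux := sol_boundary xB t0 tT; rewrite pnormalE in ux.
rewrite -[leRHS]addr0.
apply: (@balance_root_le _ _ S p (cut_weight S w x) p1 _ _ _ _ (fun=> 0) _ 0 _ ux).
- by move=> y _; exact: (cut_weight_ge0 S hG).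
- exact: (boundary_weight hG xB).
- by rewrite /balance; apply: big1 => y _; rewrite subr0 phi0 mul0r.
- by move=> y yS; rewrite addr0 sol_ge0_interior.
Qed.

(** The largest value is at least the mean, which makes the mass grow at least
like its own power q. *)
Lemma mass_growth t : 1 < q -> S != finset.set0 -> 0 < t -> (t%:E < T)%E ->
  lambda * ((\sum_(x in S) u x t) / #|S|%:R) `^ q <= \sum_(x in S) rhs x t.
Proof.
move=> q1 S0 t0 tT; rewrite sum_rhs// ler_pM2l//.
have n0 : (0 : R) < #|S|%:R by rewrite ltr0n card_gt0.
have q0 : 0 < q by rewrite (lt_trans ltr01).
have uq x : x \in S -> `|u x t| `^ (q - 1) * u x t = u x t `^ q.
  move=> xS; have ux := sol_ge0_interior q1 xS (ltW t0) tT.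
  by rewrite ger0_norm// mulrC mulr_powRB1.
set M := \sum_(x in S) u x t.
have [x xS Mx] : exists2 x, x \in S & M / #|S|%:R <= u x t.
  apply: contrapT => H; have H' x : x \in S -> u x t < M / #|S|%:R.
    by move=> xS; rewrite ltNge; apply/negP => h; apply: H; exists x.
  have : M < \sum_(x in S) M / #|S|%:R.
    have /finset.set0Pn[x0 x0S] := S0.
    rewrite [ltLHS](bigD1 x0)//= [ltRHS](bigD1 x0)//= ltr_leD ?H'//.
    by apply: ler_sum => x /andP[xS _]; exact/ltW/H'.
  by rewrite sumr_const -(mulr_natr (M / _)) divfK ?gt_eqF// ltxx.
apply: (@le_trans _ _ (u x t `^ q)).
  apply: ge0_ler_powR; rewrite ?nnegrE ?(ltW q0)//; last exact: sol_ge0_interior q1 xS (ltW t0) tT.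
  by rewrite divr_ge0// sumr_ge0// => y yS; exact: sol_ge0_interior q1 yS (ltW t0) tT.
rewrite (bigD1 x)//= uq// lerDl sumr_ge0// => y /andP[yS _].
by rewrite uq// powR_ge0.
Qed.

(** Data carried only by the boundary are excluded by the boundary condition at
time 0, which would force the boundary values to vanish as well. *)
Lemma mass0_gt0 : (exists2 x, x \in gclosure e S & u0 x != 0) ->
  0 < \sum_(x in S) u x 0.
Proof.
move=> [x0 x0c x0n].
have u00 x : x \in gclosure e S -> 0 <= u x 0.
  by move=> xc; rewrite (solves_initial usol)// u0_ge0.
have uS x : x \in S -> 0 <= u x 0 by move=> xS; rewrite u00// mem_gclosure.
rewrite lt_def sumr_ge0// andbT; apply: contraNneq x0n => M0.
have uS0 x : x \in S -> u x 0 = 0.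
  exact: (psumr_eq0P uS M0).
rewrite -(solves_initial usol x0c).
move: (x0c); rewrite /gclosure finset.in_setU => /orP[/uS0 ->//|xB].
rewrite eq_le u00// andbT -[leRHS]addr0.
have ux := sol_boundary xB (lexx 0) T0; rewrite pnormalE in ux.
apply: (@balance_root_le _ _ S p (cut_weight S w x0) p1 _ _ _ _ _ (fun=> 0) 0 ux).
- by move=> y _; exact: (cut_weight_ge0 S hG).
- exact: (boundary_weight hG xB).
- by rewrite /balance; apply: big1 => y _; rewrite subr0 phi0 mul0r.
- by move=> y yS; rewrite addr0 uS0.
Qed.

Lemma mass_ge t : 1 < q -> S != finset.set0 -> 0 < t -> (t%:E < T)%E ->
  \sum_(x in S) u x 0 <= \sum_(x in S) u x t.
Proof.
move=> q1 S0 t0 tT; rewrite -lerN2.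
apply: (@derive_le0_le_right R (fun s => - \sum_(x in S) u x s)
   (fun s => - \sum_(x in S) rhs x s)) => //.
- by apply: cvgN; apply: cvg_sum_in => x xS; exact: sol_right (mem_gclosure e xS).
- move=> s /andP[s0 st]; apply: is_deriveN; apply: is_derive_sum_in => x xS.
  exact: sol_is_derive xS s0 (before tT st).
- move=> s /andP[s0 st]; rewrite oppr_le0.
  apply: le_trans (mass_growth q1 S0 s0 (before tT st)).
  by rewrite mulr_ge0 ?powR_ge0// ltW.
Qed.

(** By [mass_growth] the power 1 - q of the mass decreases at least linearly,
yet it stays nonnegative. *)
Lemma lifespan_finite : 1 < q -> S != finset.set0 ->
  (exists2 x, x \in gclosure e S & u0 x != 0) -> T != +oo%E.
Proof.
move=> q1 S0 u0n; apply/eqP => Ty.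
have tT t : (t%:E < T)%E by rewrite Ty ltry.
have M0 := mass0_gt0 u0n.
have n0 : (0 : R) < #|S|%:R by rewrite ltr0n card_gt0.
pose M t := \sum_(x in S) u x t.
have Mt t : 0 < t -> 0 < M t by move=> t0; apply: (lt_le_trans M0); exact: mass_ge.
pose c := (q - 1) * (lambda * #|S|%:R^-1 `^ q).
have c0 : 0 < c by rewrite !mulr_gt0 ?powR_gt0 ?invr_gt0 ?subr_gt0.
pose g t := M t `^ (1 - q) + c * t.
have g_le b : 1 <= b -> g b <= g 1.
  move=> b1; apply: (@derive_le0_le R g (fun s =>
    (1 - q) * M s `^ (1 - q - 1) * (\sum_(x in S) rhs x s) + c * 1)) => // s /andP[s1 sb];
    have s0 : 0 < s by rewrite (lt_le_trans ltr01).
    have dM : is_derive s (1 : R) M (\sum_(x in S) rhs x s).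
      by apply: is_derive_sum_in => x xS; exact: sol_is_derive.
    have h : is_derive s (1 : R) (fun s => c * s) (c * 1).
      exact: (@is_deriveZ _ _ _ (@id R) c s 1 1).
    exact: (is_deriveD (@is_derive1_comp R (fun a => a `^ (1 - q)) M s _ _
      (is_derive1_powR _ (Mt s s0)) dM) h).
  have := mass_growth q1 S0 s0 (tT s); rewrite -/(M s).
  rewrite powRM ?invr_ge0 ?(ltW (Mt s s0)) ?(ltW n0)//.
  set rs := \sum_(x in S) _ => Hrs.
  have P0 : 0 < M s `^ (1 - q - 1) by rewrite powR_gt0 ?Mt.
  have PP : M s `^ (1 - q - 1) * M s `^ q = 1.
    rewrite -powRD; last by rewrite (gt_eqF (Mt s s0)) implybT.
    by rewrite (_ : 1 - q - 1 + q = 0) ?powRr0//; ring.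
  have : (q - 1) * M s `^ (1 - q - 1) * (lambda * (M s `^ q * #|S|%:R^-1 `^ q))
      <= (q - 1) * M s `^ (1 - q - 1) * rs.
    by rewrite ler_wpM2l// mulr_ge0 ?(ltW P0)// subr_ge0 ltW.
  have -> : (q - 1) * M s `^ (1 - q - 1) * (lambda * (M s `^ q * #|S|%:R^-1 `^ q)) =
     c * (M s `^ (1 - q - 1) * M s `^ q) by rewrite /c; ring.
  by rewrite PP mulr1; lra.
have g10 : 0 <= g 1 by rewrite addr_ge0 ?powR_ge0// mulr1 ltW.
(* At this time the linear part of g alone exceeds g 1. *)
have b1 : 1 <= g 1 / c + 1 by rewrite lerDr divr_ge0// ltW.
have := g_le _ b1; rewrite {1}/g mulrDr mulr1 mulrCA divff ?gt_eqF// mulr1.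
have := powR_ge0 (M (g 1 / c + 1)) (1 - q); lra.
Qed.

(** Neighbours have nonnegative values, so a vertex can lose at most
[phi p (u x t)] along each edge. *)
Lemma rhs_ge_flux x t : 1 < q -> x \in S -> 0 < t -> (t%:E < T)%E ->
  - (\sum_(y in gclosure e S) cut_weight S w x y) * phi p (u x t) <= rhs x t.
Proof.
move=> q1 xS t0 tT; have ux := sol_ge0_interior q1 xS (ltW t0) tT.
rewrite /rhs -[leLHS]addr0; apply: lerD; last first.
  by rewrite /react mulr_ge0 ?(ltW l0)// mulr_ge0// powR_ge0.
rewrite plaplacianE mulNr mulr_suml -sumrN; apply: ler_sum => y yc.
rewrite mulrC -mulNr ler_wpM2r ?(cut_weight_ge0 S hG)// -phiN; apply: ler_phi => //.
by have := sol_ge0 q1 yc (ltW t0) tT; lra.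
Qed.

Lemma blowup_or_all_converge r : 1 < q -> S != finset.set0 -> T = r%:E ->
  (exists2 x, x \in S & `|u x t| @[t --> r^'-] --> +oo) \/
  (forall x, x \in S -> exists l : R, u x t @[t --> r^'-] --> l).
Proof.
move=> q1 S0 Tr; have r0 : 0 < r by move: T0; rewrite Tr lte_fin.
have [H|H] := pselect (exists2 x, x \in S & u x t @[t --> r^'-] --> +oo).
  left; have [x xS ux] := H; exists x => //.
  apply/cvgryPge => A; have /cvgryPge/(_ A) := ux; apply: filterS => t At.
  by rewrite (le_trans At)// ler_norm.
right=> x xS.
pose W := \sum_(y in gclosure e S) cut_weight S w x y.
have W0 : 0 <= W by apply: sumr_ge0 => y _; exact: (cut_weight_ge0 S hG).
have [||||//] := @blowup_or_limit R p r W (u x) (rhs x) p1 r0 W0.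
- by move=> t /andP[t0 tr]; apply: sol_is_derive => //; rewrite Tr lte_fin.
- by move=> t /andP[t0 tr]; apply: sol_ge0_interior; rewrite ?Tr ?lte_fin// ltW.
- by move=> t /andP[t0 tr]; apply: rhs_ge_flux; rewrite ?Tr ?lte_fin.
- by move=> ux; exfalso; apply: H; exists x.
Qed.
End Solution.

(** * The Euler scheme and Peano's theorem *)

Lemma ultrafilter_fmap (T T' : Type) (f : T -> T') (U : set_system T) :
  UltraFilter U -> UltraFilter (f @ U).
Proof.
move=> UU; split; first exact: fmap_proper_filter.
move=> G GG UG; apply/seteqP; split=> [A GA|]; last exact: UG.
have [//|/(UG (~` A)) nA] := in_ultra_setVsetC (f @^-1` A) UU.
by have /filter_ex [? []] : G (A `&` ~` A) by exact: filterI.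
Qed.

(** Continuity for the product topology on [I -> R], in coordinates. *)
Definition coord_continuous (R : realType) (I : finType)
    (F : (I -> R) -> I -> R) :=
  forall X eta, 0 < eta -> exists2 delta, 0 < delta & forall Y,
    (forall i, `|Y i - X i| < delta) -> forall i, `|F Y i - F X i| < eta.

(** Existence for continuous vector fields by the Euler scheme. The step functions
taking the Euler values on the grid of mesh 1/(n+1) are bounded at each time, so
they converge pointwise along any nonprincipal ultrafilter on the natural numbers.
Convergence at the single time [t] already controls the approximations on a whole
neighbourhood of [t], because they move at speed at most [C]; this yields the
derivative at [t] of the limit, with no uniform convergence or integral. *)
Section Peano.
Context {R : realType} {I : finType} (F : (I -> R) -> I -> R) (x0 : I -> R).

Definition euler (h : R) (k : nat) : I -> R :=
  iter k (fun Y i => Y i + h * F Y i) x0.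

Lemma euler_slopeD h k j i f eta : 0 <= h ->
  (forall l, (k <= l < k + j)%N -> `|F (euler h l) i - f| <= eta) ->
  `|euler h (k + j) i - euler h k i - h * j%:R * f| <= eta * (h * j%:R).
Proof.
move=> h0; elim: j => [|j IH] Hf.
  by rewrite addn0 mulr0 mul0r subrr subr0 normr0 mulr0.
have {}IH : `|euler h (k + j) i - euler h k i - h * j%:R * f| <= eta * (h * j%:R).
  by apply: IH => l /andP[kl lj]; apply: Hf; rewrite kl addnS ltnS ltnW.
have Hj : h * `|F (euler h (k + j)) i - f| <= h * eta.
  by apply: ler_wpM2l => //; apply: Hf; rewrite leq_addr addnS ltnS leqnn.
rewrite addnS -natr1.
have -> : euler h (k + j).+1 i = euler h (k + j) i + h * F (euler h (k + j)) i by [].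
have -> : euler h (k + j) i + h * F (euler h (k + j)) i - euler h k i
    - h * (j%:R + 1) * f
  = (euler h (k + j) i - euler h k i - h * j%:R * f)
    + h * (F (euler h (k + j)) i - f) by ring.
apply: (le_trans (ler_normD _ _)); rewrite normrM (ger0_norm h0).
by apply: (le_trans (lerD IH Hj)); rewrite le_eqVlt; apply/orP; left; apply/eqP; ring.
Qed.

Lemma euler_slope h m n i f eta : 0 <= h ->
  (forall l, (minn m n <= l < maxn m n)%N -> `|F (euler h l) i - f| <= eta) ->
  `|euler h m i - euler h n i - h * (m%:R - n%:R) * f|
    <= eta * (h * `|m%:R - n%:R|).
Proof.
move=> h0; have [mn|nm] := leqP m n => Hf.
  have := @euler_slopeD h m (n - m) i f eta h0; rewrite subnKC// natrB// => /(_ Hf).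
  rewrite (@ler0_norm _ (m%:R - n%:R)) ?subr_le0 ?ler_nat// opprB -[leLHS]normrN.
  apply: le_trans; rewrite le_eqVlt; apply/orP; left; apply/eqP; congr `|_|; ring.
have {}nm := ltnW nm.
have := @euler_slopeD h n (m - n) i f eta h0; rewrite subnKC// natrB// => /(_ Hf).
by rewrite (@ger0_norm _ (m%:R - n%:R)) ?subr_ge0 ?ler_nat.
Qed.

Definition euler_step (n : nat) (t : R) : I -> R :=
  euler n.+1%:R^-1 (Num.truncn (t * n.+1%:R)).

Lemma grid_dist (n : nat) (t : R) : 0 <= t ->
  `|n.+1%:R^-1 * (Num.truncn (t * n.+1%:R))%:R - t| <= n.+1%:R^-1.
Proof.
move=> t0; have n0 : (0 : R) < n.+1%:R by [].
have /truncn_itv/andP[h1 h2] : 0 <= t * n.+1%:R by rewrite mulr_ge0.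
rewrite -(ler_pM2l n0) -[X in X * `|_|](gtr0_norm n0) -normrM mulrBr mulrA.
rewrite divff ?gt_eqF// mul1r (mulrC _ t) distrC ger0_norm ?subr_ge0//.
by rewrite lerBlDl natr1 ltW.
Qed.

Variable C : R.
Hypothesis FC : forall X i, `|F X i| <= C.
Hypothesis Fcont : coord_continuous F.

Lemma euler_step_bounded n t i : 0 <= t -> `|euler_step n t i - x0 i| <= C * (t + 1).
Proof.
move=> t0; have n0 : (0 : R) < n.+1%:R^-1 by rewrite invr_gt0.
have C0 : 0 <= C := le_trans (normr_ge0 _) (FC x0 i).
have := @euler_slopeD n.+1%:R^-1 0 (Num.truncn (t * n.+1%:R)) i 0 C (ltW n0).
rewrite mulr0 subr0 add0n => /(_ _)/le_trans; apply; first by move=> l _; rewrite subr0.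
apply: ler_wpM2l => //; have := grid_dist n t0; rewrite ler_norml => /andP[_].
rewrite lerBlDl => /le_trans; apply; rewrite lerD2l invf_le1//.
by rewrite ler1n.
Qed.

(** The radius [rho] is uniform in [n]: near [t] the Euler values stay in the
ball of radius [delta] around [X], where the field is [eta]-close to [F X]. *)
Lemma euler_step_slope t X eta : 0 <= t -> 0 < eta ->
  exists2 rho, 0 < rho & forall n s, 0 <= s -> `|s - t| < rho ->
    n.+1%:R^-1 < rho -> (forall i, `|euler_step n t i - X i| < rho) ->
    forall i, `|euler_step n s i - euler_step n t i - (s - t) * F X i|
      <= eta * `|s - t| + 2 * (eta + C) * n.+1%:R^-1.
Proof.
move=> t0 eta0; have [delta d0 Hd] := Fcont X eta0.
have C0 i : 0 <= C := le_trans (normr_ge0 _) (FC x0 i).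
(* The drift over a time 3 rho is at most 3 C rho, and the start is rho-close to X. *)
exists (delta / (4 * (`|C| + 1))).
  by rewrite divr_gt0// mulr_gt0// ltr_wpDl.
set rho := delta / _ => n s s0 st hn HX i.
have {}C0 := C0 i.
have rhoC : rho * (4 * (C + 1)) = delta.
  by rewrite /rho (ger0_norm C0) divfK// mulf_neq0// gt_eqF// ltr_wpDl.
set h : R := n.+1%:R^-1 in hn *.
have h0 : 0 < h by rewrite invr_gt0.
have Gs := grid_dist n s0; have Gt := grid_dist n t0.
rewrite /euler_step -/h in HX *.
set ks := Num.truncn (s * _) in Gs *; set kt := Num.truncn (t * _) in HX Gt *.
rewrite -/h in Gs Gt.
have Dst : `|h * (ks%:R - kt%:R) - (s - t)| <= 2 * h.
  have -> : h * (ks%:R - kt%:R) - (s - t) = (h * ks%:R - s) - (h * kt%:R - t) by ring.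
  by apply: (le_trans (ler_normB _ _)); lra.
have Dst' : h * `|ks%:R - kt%:R| <= `|s - t| + 2 * h.
  rewrite -[X in X * _](gtr0_norm h0) -normrM.
  rewrite -[h * _](subrK (s - t)); apply: (le_trans (ler_normD _ _)); lra.
have near_t l : (minn ks kt <= l < maxn ks kt)%N -> forall j, `|euler h l j - X j| < delta.
  move=> lk j; have Hl : h * `|l%:R - kt%:R| <= h * `|ks%:R - kt%:R|.
    rewrite ler_pM2l//; move: lk; have [kk|kk] := leqP ks kt => /andP[l1 l2].
      have a1 : (ks%:R : R) <= kt%:R by rewrite ler_nat.
      have a2 : (ks%:R : R) <= l%:R by rewrite ler_nat.
      have a3 : (l%:R : R) <= kt%:R by rewrite ler_nat ltnW.
      by rewrite !ler0_norm ?subr_le0//; lra.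
    have a1 : (kt%:R : R) <= ks%:R by rewrite ler_nat ltnW.
    have a2 : (l%:R : R) <= ks%:R by rewrite ler_nat ltnW.
    have a3 : (kt%:R : R) <= l%:R by rewrite ler_nat.
    by rewrite !ger0_norm ?subr_ge0//; lra.
  have H : `|euler h l j - euler h kt j| <= C * (h * `|l%:R - kt%:R|).
    have := @euler_slope h l kt j 0 C (ltW h0); rewrite mulr0 subr0; apply=> l' _.
    by rewrite subr0; exact: FC.
  have H2 : C * (h * `|l%:R - kt%:R|) <= C * (3 * rho).
    by apply: ler_wpM2l => //; lra.
  have H3 := HX j.
  rewrite -[_ - X j](subrKA (euler h kt j)).
  apply: (le_lt_trans (ler_normD _ _)).
  have : C * rho >= 0 by rewrite mulr_ge0// ltW// (le_lt_trans _ st).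
  have rho0 : 0 < rho by apply: lt_trans hn.
  lra.
have Hs : `|euler h ks i - euler h kt i - h * (ks%:R - kt%:R) * F X i|
    <= eta * (h * `|ks%:R - kt%:R|).
  by apply: euler_slope (ltW h0) _ => l lk; apply/ltW/Hd/near_t.
have -> : euler h ks i - euler h kt i - (s - t) * F X i =
  (euler h ks i - euler h kt i - h * (ks%:R - kt%:R) * F X i)
  + (h * (ks%:R - kt%:R) - (s - t)) * F X i by ring.
apply: (le_trans (ler_normD _ _)); rewrite normrM.
have A1 : `|h * (ks%:R - kt%:R) - (s - t)| * `|F X i| <= 2 * h * C.
  by apply: ler_pM.
have A2 : eta * (h * `|ks%:R - kt%:R|) <= eta * (`|s - t| + 2 * h) by rewrite ler_pM2l.
lra.
Qed.

Lemma peano_bounded : exists2 X : R -> I -> R, X 0 = x0 &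
  forall t eta, 0 <= t -> 0 < eta -> exists2 rho, 0 < rho &
    forall s, 0 <= s -> `|s - t| < rho -> forall i,
    `|X s i - X t i - (s - t) * F (X t) i| <= eta * `|s - t|.
Proof.
have [U [UU ooU]] := @ultraFilterLemma nat \oo _.
pose X (t : R) i := lim (euler_step n t i @[n --> U]).
have cX t i : 0 <= t -> euler_step n t i @[n --> U] --> X t i.
  move=> t0; apply/cvg_ex.
  pose K := `[x0 i - C * (t + 1), x0 i + C * (t + 1)]%classic.
  have cK : compact K := @segment_compact _ _ _.
  rewrite compact_ultra in cK.
  have [] := cK ((fun n => euler_step n t i) @ U).
    - exact: ultrafilter_fmap.
    - apply: (@filterE _ U) => n; rewrite /K /= in_itv /=.
      by have := euler_step_bounded n i t0; rewrite ler_distl.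
  by move=> l [_ Hl]; exists l.
exists X.
  apply/funext => i; rewrite /X; apply/cvg_lim => //.
  rewrite (_ : (fun n => euler_step n 0 i) = cst (x0 i)); first exact: cvg_cst.
  by apply/funext => n; rewrite /euler_step mul0r truncn0.
move=> t eta t0 eta0; have [rho rho0 Hrho] := euler_step_slope (X t) t0 eta0.
exists rho => // s s0 st i.
have cD : `|euler_step n s i - euler_step n t i - (s - t) * F (X t) i| @[n --> U]
    --> `|X s i - X t i - (s - t) * F (X t) i|.
  by apply: cvg_norm; apply: cvgB; [apply: cvgB; exact: cX|exact: cvg_cst].
have hU : (n.+1%:R^-1 : R) @[n --> U] --> (0 : R).
  by move=> A /(@cvg_harmonic R); exact: ooU.
have cB : eta * `|s - t| + 2 * (eta + C) * n.+1%:R^-1 @[n --> U] --> eta * `|s - t|.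
  rewrite -[X in _ --> X]addr0 -[X in _ --> _ + X](mulr0 (2 * (eta + C))).
  by apply: cvgD; [exact: cvg_cst|apply: cvgM => //; exact: cvg_cst].
apply: (ler_cvg_to cD cB).
have near_t : \forall n \near U, forall j, `|euler_step n t j - X t j| < rho.
  by apply: filter_forall => j; move/cvgrPdistC_lt : (cX t j t0); exact.
have small : \forall n \near U, (n.+1%:R^-1 : R) < rho by exact: cvgr_lt hU _ _.
by near=> n; apply: Hrho => //; near: n.
Unshelve. all: by end_near. Qed.
End Peano.

Definition box_nbhs (R : realType) (I : finType) (X : I -> R) : set_system (I -> R) :=
  fun P => exists2 delta, 0 < delta & forall Y, (forall i, `|Y i - X i| < delta) -> P Y.

Section Box.
Context {R : realType} {I : finType}.
Implicit Types (X : I -> R) (F : (I -> R) -> I -> R).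

Global Instance box_nbhs_filter X : Filter (box_nbhs X).
Proof.
split=> [|P Q [d d0 Pd] [d' d'0 Qd]|P Q PQ [d d0 Pd]].
- by exists 1.
- exists (Num.min d d'); first by rewrite lt_min d0.
  move=> Y HY; split; [apply: Pd|apply: Qd] => i; apply: lt_le_trans (HY i) _.
    by rewrite ge_min lexx.
  by rewrite ge_min lexx orbT.
- by exists d => // Y /Pd/PQ.
Qed.

Lemma cvg_coord X i : Y i @[Y --> box_nbhs X] --> X i.
Proof. by apply/cvgrPdistC_lt => eta eta0; exists eta. Qed.

Lemma coord_continuousP F :
  coord_continuous F <-> forall X i, F Y i @[Y --> box_nbhs X] --> F X i.
Proof.
split=> [H X i|H X eta eta0].
  apply/cvgrPdistC_lt => eta eta0; have [d d0 Hd] := H X eta eta0.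
  by exists d => // Y /Hd.
suff : \forall Y \near box_nbhs X, forall i, `|F Y i - F X i| < eta.
  by case=> d d0 Hd; exists d.
by apply: filter_forall => i; move/cvgrPdistC_lt : (H X i); exact.
Qed.

Lemma coord_continuous_cvg F (T : Type) (G : set_system T) (Y : T -> I -> R) X :
  Filter G -> coord_continuous F -> (forall i, Y t i @[t --> G] --> X i) ->
  forall i, F (Y t) i @[t --> G] --> F X i.
Proof.
move=> GF Fc YX i; apply/cvgrPdistC_lt => eta eta0.
have [d d0 Hd] := Fc X eta eta0.
have : \forall t \near G, forall i, `|Y t i - X i| < d.
  by apply: filter_forall => j; move/cvgrPdistC_lt : (YX j); exact.
by apply: (@filterS _ G) => t /Hd/(_ i).
Qed.

(** Clamping the values of the field makes it bounded, and does not change it near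
[x0]. The time 0 is included, with a one-sided derivative, so that the
solution can be glued to one coming from the left. *)
Lemma peano F x0 : coord_continuous F -> exists eps (X : R -> I -> R),
  [/\ 0 < eps, X 0 = x0 & forall t eta, 0 <= t -> t < eps -> 0 < eta ->
    exists2 rho, 0 < rho & forall s, 0 <= s -> `|s - t| < rho -> forall i,
    `|X s i - X t i - (s - t) * F (X t) i| <= eta * `|s - t|].
Proof.
move=> Fc; pose C := 1 + \sum_i `|F x0 i|.
have C0 : 0 < C by rewrite ltr_pwDl// sumr_ge0.
pose clamp (a : R) := Num.max (- C) (Num.min C a).
have clamp_id a : `|a| <= C -> clamp a = a.
  by rewrite ler_norml => /andP[h1 h2]; rewrite /clamp (min_idPr h2) (max_idPr h1).
have clamp_le a : `|clamp a| <= C.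
  by rewrite ler_norml /clamp le_max lexx/= ge_max ge_min lexx/= andbT; lra.
have clamp_lip a b : `|clamp a - clamp b| <= `|a - b|.
  rewrite /clamp; case: (leP C a) => h1; case: (leP C b) => h2; rewrite ?subrr ?normr0//;
    case: (leP (- C) _) => h3; case: (leP (- C) _) => h4;
    rewrite ?subrr ?normr0// !ler_norml; apply/andP; split;
    have := ler_norm (a - b); have := ler_norm (- (a - b)); rewrite normrN => *; lra.
pose G X i := clamp (F X i).
have Gc : coord_continuous G.
  move=> X eta eta0; have [d d0 Hd] := Fc X eta eta0.
  by exists d => // Y /Hd H i; apply: le_lt_trans (H i); exact: clamp_lip.
have [X X0 HX] := @peano_bounded R I G x0 C (fun X i => clamp_le _) Gc.
have [d d0 Hd] := Fc x0 1 ltr01.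
have [rho rho0 Hrho] := HX 0 1 (lexx _) ltr01.
have C1 : 0 < C + 1 by rewrite addr_gt0.
exists (Num.min rho (d / (C + 1))), X; split => //.
  by rewrite lt_min rho0 divr_gt0.
move=> t eta t0; rewrite lt_min => /andP[trho td] eta0.
have near0 i : `|X t i - x0 i| < d.
  have := Hrho t t0; rewrite subr0 ger0_norm// => /(_ trho i).
  rewrite X0 mul1r => h.
  have h2 : `|t * G x0 i| <= t * C.
    by rewrite normrM (ger0_norm t0); apply: ler_wpM2l => //; exact: clamp_le.
  rewrite ltr_pdivlMr// in td.
  rewrite -[_ - x0 i](subrK (t * G x0 i)).
  by apply: (le_lt_trans (ler_normD _ _)); lra.
have GF i : G (X t) i = F (X t) i.
  apply: clamp_id; have := Hd _ near0 i => h.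
  rewrite -[F _ _](subrK (F x0 i)); apply: (le_trans (ler_normD _ _)).
  rewrite /C lerD ?(ltW h)//.
  by rewrite (bigD1 i)//= lerDl sumr_ge0.
have [rho' rho'0 Hrho'] := HX t eta t0 eta0; exists rho' => // s s0 st i.
by rewrite -GF; exact: Hrho'.
Qed.

End Box.

(** * Elimination of the boundary values *)

Section Extension.
Context {R : realType} {V : finType} (e : rel V) (w : V -> V -> R) (S : {set V}).
Context {p q lambda : R}.
Hypotheses (hG : is_network e w) (p1 : 1 < p) (q0 : 0 < q).
Implicit Types (X Y f : V -> R) (x y z : V).

Let react (a : R) := lambda * (`|a| `^ (q - 1) * a).

(** The configuration on the closure that the values on [S] determine. *)
Definition fill X y : R :=
  if y \in S then X y else balance_root S p (cut_weight S w y) X.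

(** The right-hand side of the equation once the boundary values have been
eliminated: the problem becomes an ordinary differential equation on [S]. *)
Definition interior_field X x : R := plaplacian e S w p (fill X) x + react (X x).

Let k0 y : forall x, x \in S -> 0 <= cut_weight S w y x.
Proof. by move=> x _; exact: (cut_weight_ge0 S hG). Qed.

Lemma fill_boundary X z : z \in boundary e S -> pnormal S w p (fill X) z = 0.
Proof.
move=> zB; rewrite pnormalE /fill (negPf (boundary_notin zB)).
rewrite -[RHS](balance_rootP p1 (k0 z) X).
by apply: eq_bigr => y yS; rewrite yS.
Qed.

Lemma fill_unique f X x : x \in gclosure e S ->
  (forall y, y \in S -> X y = f y) ->
  (forall z, z \in boundary e S -> pnormal S w p f z = 0) -> fill X x = f x.
Proof.
move=> xc Xf fB; rewrite /fill; case: ifPn => xS; first exact: Xf.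
have xB : x \in boundary e S.
  by move: xc; rewrite /gclosure finset.in_setU (negPf xS).
apply/esym; apply: (balance_root_unique p1 (k0 x) (boundary_weight hG xB)).
rewrite -[RHS](fB x xB) pnormalE; apply: eq_bigr => y yS; by rewrite Xf.
Qed.

Lemma interior_field_eq f X x : x \in S -> (forall y, y \in S -> X y = f y) ->
  (forall z, z \in boundary e S -> pnormal S w p f z = 0) ->
  interior_field X x = plaplacian e S w p f x + react (f x).
Proof.
move=> xS Xf fB; rewrite /interior_field Xf//; congr (_ + _); apply: eq_bigr => y yc.
by rewrite !(fill_unique _ Xf fB)// mem_gclosure.
Qed.

Lemma fill_cvg X y : y \in gclosure e S -> fill Y y @[Y --> box_nbhs X] --> fill X y.
Proof.
move=> yc; rewrite /fill; case: ifPn => yS; first exact: cvg_coord.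
have yB : y \in boundary e S.
  by move: yc; rewrite /gclosure finset.in_setU (negPf yS).
apply/cvgrPdistC_le => eta eta0; exists eta => // Y HY.
apply: (balance_root_dist p1 (k0 y) (boundary_weight hG yB)).
by move=> x _; exact/ltW/HY.
Qed.

Lemma reactE a : react a = lambda * phi (q + 1) a.
Proof. by rewrite /react /phi; congr (_ * (_ `^ _ * _)); ring. Qed.

Lemma interior_field_continuous :
  coord_continuous (fun X x => if x \in S then interior_field X x else 0).
Proof.
apply/coord_continuousP => X x; case: ifPn => xS; last exact: cvg_cst.
rewrite /interior_field; under eq_fun do rewrite reactE.
rewrite reactE; apply: cvgD; last first.
  apply: cvgM; first exact: cvg_cst.
  have q1 : 1 < q + 1 by rewrite ltrDr.
  exact: (cvg_comp _ _ (@cvg_coord R V X x) (phi_continuous q1 (x := X x))).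
rewrite plaplacianE; under eq_fun do rewrite plaplacianE.
apply: cvg_sum_in => y yc; apply: cvgM; last exact: cvg_cst.
have c : fill Y y - fill Y x @[Y --> box_nbhs X] --> fill X y - fill X x.
  by apply: cvgB; apply: fill_cvg => //; exact: mem_gclosure.
exact: (cvg_comp _ _ c (phi_continuous p1 (x := fill X y - fill X x))).
Qed.

Lemma fill_derivable (X : R -> V -> R) t :
  (forall y, y \in S -> derivable (X ^~ y) t 1) ->
  forall y, y \in gclosure e S -> derivable (fun s => fill (X s) y) t 1.
Proof.
move=> dX y yc; have [yS|yS] := boolP (y \in S).
  by rewrite /fill yS; exact: dX.
rewrite /fill (negPf yS).
have yB : y \in boundary e S.
  by move: yc; rewrite /gclosure finset.in_setU (negPf yS).
have k1 := boundary_weight hG yB.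
apply: (@balance_root_derivable R V S p (cut_weight S w y) p1 (k0 y) k1 X
  (fun s => balance_root S p (cut_weight S w y) (X s)) t dX) => s.
exact: (balance_rootP p1 (k0 y)).
Qed.
End Extension.

(** * Continuation and the theorem *)

(** A solution whose interior values all converge at [r] continues past [r]: solve
the equation with the limits as initial values, and recompute the boundary values
at all times from the interior ones. *)
Lemma solves_extend (R : realType) (V : finType) (e : rel V) (w : V -> V -> R)
    (S : {set V}) (mu sigma u0 : V -> R) (p q lambda r : R) (u : V -> R -> R) :
  is_network e w -> 1 < p -> 0 < q -> 0 < r ->
  (forall z, z \in boundary e S -> 0 < mu z) ->
  (forall z, z \in boundary e S -> sigma z = 0) ->
  solves e S w p q lambda mu sigma u0 r%:E u ->
  (forall x, x \in S -> exists l : R, u x t @[t --> r^'-] --> l) ->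
  exists T' v, [/\ (r%:E < T')%E, solves e S w p q lambda mu sigma u0 T' v &
    forall x, x \in gclosure e S -> forall t, 0 <= t -> t < r -> v x t = u x t].
Proof.
move=> hG p1 q0 r0 mu_gt0 sigma0 usol ul.
have r0' : (0 < r%:E)%E by rewrite lte_fin.
have /choice[l ulP] : forall x, exists l : R, x \in S -> u x t @[t --> r^'-] --> l.
  by move=> x; have [xS|_] := boolP (x \in S); [have [l] := ul x xS; exists l|exists 0].
pose X0 x := if x \in S then l x else 0.
pose uS t x := if x \in S then u x t else 0.
pose fld := @interior_field R V e w S p q lambda.
pose F (X : V -> R) x := if x \in S then fld X x else 0.
have Fc : coord_continuous F := @interior_field_continuous R V e w S p q lambda hG p1 q0.
have [eps [X [eps0 XX0 HX]]] := peano X0 Fc.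
pose vS t : V -> R := if t < r then u ^~ t else X (t - r).
pose v x t := @fill R V w S p (vS t) x.
have bu t z : 0 <= t -> t < r -> z \in boundary e S -> pnormal S w p (u ^~ t) z = 0.
  by move=> t0 tr zB; apply: (sol_boundary mu_gt0 sigma0 usol).
have vu x t : x \in gclosure e S -> 0 <= t -> t < r -> v x t = u x t.
  move=> xc t0 tr; apply: (fill_unique hG p1 xc (f := u ^~ t)); last by move=> z; exact: bu.
  by move=> y yS; rewrite /vS tr.
have du t x : x \in S -> 0 < t < r -> is_derive t (1 : R) (u x) (fld (uS t) x).
  move=> xS /andP[t0 tr].
  rewrite /fld (@interior_field_eq _ _ _ _ _ _ _ _ hG p1 (u ^~ t))//.
  - by apply: (sol_is_derive usol).
  - by move=> y yS; rewrite /uS yS.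
  - by move=> z; apply: bu => //; exact: ltW.
have dvS t x : x \in S -> 0 < t -> t < r + eps ->
    is_derive t (1 : R) (fun s => vS s x) (fld (vS t) x).
  move=> xS t0 teps; have [tr|rt] := ltP t r.
    have -> : fld (vS t) x = fld (uS t) x.
      rewrite /fld !(@interior_field_eq _ _ _ _ _ _ _ _ hG p1 (u ^~ t))//.
      - by move=> y yS; rewrite /uS yS.
      - by move=> z; apply: bu => //; exact: ltW.
      - by move=> y yS; rewrite /vS tr.
      - by move=> z; apply: bu => //; exact: ltW.
    apply: (@near_eq_is_derive _ _ _ (u x)); last by apply: du; rewrite ?t0.
    by near=> s; rewrite /vS ifT//; near: s; exact: lt_nbhsl.
  have vSt : vS t = X (t - r) by rewrite /vS ltNge rt.
  have FX : F (X (t - r)) x = fld (vS t) x by rewrite /F xS vSt.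
  apply: is_derive_slope => eta eta0.
  have tr0 : 0 <= t - r by rewrite subr_ge0.
  have tr_eps : t - r < eps by rewrite ltrBlDl.
  have [rho rho0 Hrho] := HX (t - r) eta tr0 tr_eps eta0.
  have right s : r <= s -> `|s - t| < rho ->
      `|vS s x - vS t x - (s - t) * fld (vS t) x| <= eta * `|s - t|.
    move=> rs st; have := Hrho (s - r); rewrite subr_ge0 => /(_ rs).
    rewrite (_ : s - r - (t - r) = s - t); last by ring.
    by move=> /(_ st x); rewrite FX vSt {1}/vS ltNge rs.
  move: rt; rewrite le_eqVlt => /predU1P[rt|rt]; last first.
    exists (Num.min rho (t - r)); first by rewrite lt_min rho0 subr_gt0.
    move=> s; rewrite lt_min => /andP[s1 s2]; apply: right => //.
    by move: s2; rewrite ltr_norml; lra.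
  (* At time r the slope from the left is the limit of the field along u. *)
  have X0t : vS t = X0 by rewrite vSt -rt subrr.
  have cdu : fld (uS s) x @[s --> r^'-] --> fld X0 x.
    have := @coord_continuous_cvg R V F R (r^'-) uS X0 (at_left_proper_filter r) Fc _ x.
    rewrite /F xS; apply=> y; rewrite /uS /X0; case: ifP => yS; first exact: ulP.
    exact: cvg_cst.
  have [rho' rho'0 Hrho'] := left_slope r0 (fun t => du t x xS) (ulP x xS) cdu eta0.
  exists (Num.min rho rho'); first by rewrite lt_min rho0.
  move=> s; rewrite lt_min => /andP[s1 s2].
  have [sr|rs] := ltP s r; last exact: right.
  by rewrite X0t {1}/vS sr /X0 xS -rt; apply: Hrho' => //; rewrite rt.
have dv t x : x \in gclosure e S -> 0 < t -> t < r + eps -> derivable (v x) t 1.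
  move=> xc t0 teps; apply: (fill_derivable hG p1) xc => y yS.
  by have [] := dvS t y yS t0 teps.
exists (r + eps)%:E, v; split; [by rewrite lte_fin ltrDl| |by move=> x xc t; exact: vu].
split.
- move=> x xc; apply/subspace_continuousP => t /= [t0 teps].
  rewrite lte_fin in teps.
  move: t0; rewrite le_eqVlt => /predU1P[t0|t0]; last first.
    apply: cvg_within_filter; apply: differentiable_continuous.
    exact/derivable1_diffP/dv.
  have /subspace_continuousP/(_ 0) := solves_continuous usol xc.
  move=> /(_ (conj (lexx 0) r0')) h U.
  rewrite -t0 => vU.
  have uU : nbhs (u x 0) U by rewrite -(vu x 0 xc (lexx _) r0); exact: vU.
  have hU : \forall t \near (0 : R), 0 <= t /\ (t%:E < r%:E)%E -> U (u x t).
    by move/h : uU; exact.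
  have hr : \forall t \near (0 : R), t < r by exact: lt_nbhsl.
  suff : \forall t \near (0 : R), 0 <= t /\ (t%:E < (r + eps)%:E)%E -> U (v x t) by [].
  apply: filterS (filterI hU hr) => s [sU sr] [s0 _].
  by rewrite vu//; apply: sU; rewrite lte_fin.
- by move=> x xc t t0; rewrite lte_fin; exact: dv.
- move=> x xS t t0; rewrite lte_fin => teps.
  have vx : v x = fun s => vS s x by apply/funext => s; rewrite /v /fill xS.
  have h := dvS t x xS t0 teps.
  rewrite vx derive1E derive_val /fld /interior_field.
  by congr (_ + _); congr (lambda * (_ * _)); rewrite /v /fill xS.
- move=> z zB t t0 _; rewrite sigma0// mul0r addr0.
  by rewrite (fill_boundary hG p1)// mulr0.
- by move=> x xc; rewrite vu//; exact: (solves_initial usol xc).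
Unshelve. all: by end_near. Qed.

Theorem theorem3p2 (R : realType) (V : finType) (e : rel V) (w : V -> V -> R)
    (S : {set V}) (mu sigma : V -> R) (p q : R)
    (hG : is_network e w) (hS : connected_on e S)
    (hmu : forall z, z \in boundary e S -> 0 <= mu z)
    (hsigma : forall z, z \in boundary e S -> 0 <= sigma z)
    (hmusigma : forall z, z \in boundary e S -> 0 < mu z + sigma z)
    (hp : 1 < p) (hq : 0 < q)
    (hsigma0 : forall z, z \in boundary e S -> sigma z = 0) :
  (forall (lambda : R) (u0 : V -> R) (T : \bar R) (u : V -> R -> R),
     (forall x, x \in gclosure e S -> 0 <= u0 x) ->
     is_solution e S w p q lambda mu sigma u0 T u ->
     forall t : R, 0 < t -> (t%:E < T)%E ->
     \sum_(x in S) derive1 (u x) t =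
       lambda * \sum_(x in S) `|u x t| `^ (q - 1) * u x t) /\
  (forall (lambda : R) (u0 : V -> R) (T : \bar R) (u : V -> R -> R),
     0 < lambda ->
     (forall x, x \in gclosure e S -> 0 <= u0 x) ->
     (exists2 x, x \in gclosure e S & u0 x != 0) ->
     is_solution e S w p q lambda mu sigma u0 T u ->
     (blows_up_in_finite_time S T u <-> 1 < q)).
Proof.
have mu_gt0 z : z \in boundary e S -> 0 < mu z.
  by move=> zB; have := hmusigma z zB; rewrite hsigma0// addr0.
split=> [lambda u0 T u u0_ge0 [T0 usol _] t t0 tT|lambda u0 T u l0 u0_ge0 u0n [T0 usol umax]].
  rewrite -(sum_rhs hG mu_gt0 hsigma0 usol t0 tT).
  by apply: eq_bigr => x xS; exact: (solves_equation usol xS t0 tT).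
split=> [[r [Tr [x xS ux]]]|q1].
  rewrite ltNge; apply/negP => q1; subst T.
  have r0 : 0 < r by rewrite lte_fin in T0.
  have [K HK] := bounded_of_q_le1 hG T0 mu_gt0 hsigma0 usol l0 hq q1 r0.
  have /cvgryPgt/(_ K) Ku := ux.
  have near_r : \forall t \near r^'-, 0 < t < r.
    by near=> t; apply/andP; split; near: t; [exact: nbhs_left_gt|exact: nbhs_left_lt].
  have both : \forall t \near r^'-, K < `|u x t| /\ 0 < t < r by exact: filterI Ku near_r.
  have [t [Kt /andP[t0 tr]]] := @filter_ex _ _ (at_left_proper_filter r) _ both.
  by have := HK t x xS t0 (ltW tr); rewrite lte_fin => /(_ tr); rewrite leNgt Kt.
have [S0 _] := hS.
have := lifespan_finite hG hp T0 mu_gt0 hsigma0 usol l0 u0_ge0 q1 S0 u0n.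
move: T0 usol umax; case: T => [r| |]// r0 usol umax _.
exists r; split => //.
have [//|ul] := blowup_or_all_converge hG hp r0 mu_gt0 hsigma0 usol l0 u0_ge0 q1 S0 (erefl _).
have [T' [v [rT' vsol vu]]] := solves_extend hG hp hq r0 mu_gt0 hsigma0 usol ul.
exfalso; apply: (umax T' v rT' vsol) => x xc t t0; rewrite lte_fin; exact: vu.
Unshelve. all: by end_near. Qed.
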